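(* Let $\mathbb K=\mathbb R$, let $g\in\mathbb R[S,S^{-1}]$, $\lambda\in\mathbb R$, and let $\{p_n\}_{n\ge0}$ be the monic eigenbasis of the fixed-lowering triple with parameters $(g,\lambda)$. The following are equivalent. (i) The sequence $\{p_n\}$ is orthogonal with respect to a positive Borel measure on $\mathbb R$ having infinite support and finite moments of all orders. (ii) There exist $a>0$ and $\beta\in\mathbb R$ such that $g(S)=-a+(a+\beta)S^{-1}$. (iii) The triple belongs to $\mathcal L_1$, with $g(S)=c_{-1}S^{-1}+c_0$ for some $c_{-1},c_0\in\mathbb R$, and its constant coefficient satisfies $c_0<0$. In this case $$\sum_{n=0}^{\infty}p_n(x)\frac{z^n}{n!}=e^{-az}(1+z)^{x+a+\beta},$$ $$xp_n=p_{n+1}+(n-\beta)p_n+an\,p_{n-1},$$ and $$p_n(x)=C_n(x+a+\beta;a),$$ where $C_n(\,\cdot\,;a)$ denotes the monic Charlier polynomial. Up to multiplication by a positive constant, the orthogonality measure is unique. It is supported at $x=k-a-\beta$, $k=0,1,2,\ldots$, with weights proportional to $e^{-a}a^k/k!$.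
   Context: $\mathcal A=\mathbb R[x]\langle S,S^{-1}\rangle/(Sx-(x+1)S)$ consists of finite sums $\sum_jt_j(x)S^j$ ($j\in\mathbb Z$, $t_j\in\mathbb R[x]$), acting on $\mathbb R[x]$ by $(Sf)(x)=f(x+1)$; $D=S-1$, $X=xS^{-1}$. A fixed-lowering triple is an $\mathfrak{sl}_2$-triple $(E,H,F)$ in $\mathcal A$ ($[H,E]=2E$, $[H,F]=-2F$, $[E,F]=H$) with $F=1-S$; these are exactly the triples $H=2(X+g)D-\lambda$, $E=(X+g)^2D-\lambda(X+g)$ with unique parameters $g\in\mathbb R[S,S^{-1}]$, $\lambda\in\mathbb R$. Its monic eigenbasis: $p_n$ is the unique monic degree-$n$ polynomial with $Hp_n=(2n-\lambda)p_n$. Writing $\operatorname{supp}_S(\sum_jt_jS^j)=\{j:t_j\ne0\}$, the triple belongs to $\mathcal L_1$ if $\operatorname{supp}_S(H)\subseteq\{-1,0,1\}$ and $\operatorname{supp}_S(E)\subseteq\{-2,-1,0,1\}$. Monic Charlier polynomials: $C_n(y;a)=\sum_{k=0}^n\binom nk(-a)^{n-k}\,y(y-1)\cdots(y-k+1)$. Here $(1+z)^{y}=\sum_{n\ge0}y(y-1)\cdots(y-n+1)z^n/n!$; $p_{-1}=0$. *)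

(* Defs.v *)
From HB Require Import structures.
From mathcomp Require Import all_boot all_order all_algebra.
From mathcomp Require Import finmap.
From mathcomp Require Import all_classical all_reals all_analysis.

Set Implicit Arguments.
Unset Strict Implicit.
Unset Printing Implicit Defensive.

Import Order.TTheory GRing.Theory Num.Theory.
Import numFieldNormedType.Exports.

Local Open Scope ring_scope.

(* The shift algebra R[x]<S, S^-1> / (S x - (x + 1) S): the value of
   P : shiftalg R at j : int is the polynomial coefficient t_j of the normal
   form \sum_j t_j S^j. *)
Definition shiftalg (R : comNzRingType) := {fsfun int -> {poly R} with 0}.

HB.instance Definition _ (R : comNzRingType) :=
  Choice.copy (shiftalg R) {fsfun int -> {poly R} with 0}.

Section ShiftAlgebra.
Variable R : comNzRingType.
Implicit Types (P Q T : shiftalg R) (f t u : {poly R}) (i j k : int).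

Definition supp_S P : {fset int} := finsupp P.

(* f(x) |-> f(x + j) *)
Definition shiftp j f : {poly R} := f \Po ('X + (j%:~R)%:P).

Definition sa_mono t j : shiftalg R := [fsfun k in [fset j]%fset => t].

Definition sa_opp P : shiftalg R := [fsfun k in supp_S P => - P k].

Definition sa_add P Q : shiftalg R :=
  [fsfun k in (supp_S P `|` supp_S Q)%fset => P k + Q k].

Lemma sa_monoE t j k : sa_mono t j k = if k == j then t else 0.
Proof. by rewrite fsfunE inE. Qed.

Lemma sa_oppE P k : sa_opp P k = - P k.
Proof. by rewrite fsfunE; case: finsuppP => // _; rewrite oppr0. Qed.

Lemma sa_addE P Q k : sa_add P Q k = P k + Q k.
Proof.
rewrite fsfunE inE; case: (finsuppP P) => //= _.
by case: (finsuppP Q) => //= _; rewrite addr0.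
Qed.

Fact sa_addA : associative sa_add.
Proof. by move=> P Q T; apply/fsfunP => k; rewrite !sa_addE addrA. Qed.

Fact sa_addC : commutative sa_add.
Proof. by move=> P Q; apply/fsfunP => k; rewrite !sa_addE addrC. Qed.

Fact sa_add0 : left_id ([fsfun] : shiftalg R) sa_add.
Proof. by move=> P; apply/fsfunP => k; rewrite sa_addE fsfunE add0r. Qed.

Fact sa_addN : left_inverse ([fsfun] : shiftalg R) sa_opp sa_add.
Proof.
by move=> P; apply/fsfunP => k; rewrite sa_addE sa_oppE fsfunE addNr.
Qed.

HB.instance Definition _ :=
  GRing.isZmodule.Build (shiftalg R) sa_addA sa_addC sa_add0 sa_addN.

Lemma coef_sa0 k : (0 : shiftalg R) k = 0.
Proof. by rewrite [LHS]fsfunE. Qed.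

Lemma coef_saD P Q k : (P + Q) k = P k + Q k.
Proof. exact: sa_addE. Qed.

Lemma coef_saN P k : (- P) k = - P k.
Proof. exact: sa_oppE. Qed.

Lemma coef_sa_sum (I : Type) (r : seq I) (C : pred I) (F : I -> shiftalg R) k :
  (\sum_(i <- r | C i) F i) k = \sum_(i <- r | C i) F i k.
Proof.
by elim/big_rec2: _ => [|i ? P _ <-]; rewrite ?coef_sa0 ?coef_saD.
Qed.

(* (t S^i)(u S^j) = t u(x + i) S^(i + j) *)
Definition sa_mul P Q : shiftalg R :=
  \sum_(i <- supp_S P) \sum_(j <- supp_S Q)
     sa_mono (P i * shiftp i (Q j)) (i + j).

Lemma shiftp0 i : shiftp i 0 = 0.
Proof. exact: comp_poly0. Qed.

Lemma shiftpD i f t : shiftp i (f + t) = shiftp i f + shiftp i t.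
Proof. exact: comp_polyD. Qed.

Lemma shiftpM i f t : shiftp i (f * t) = shiftp i f * shiftp i t.
Proof. exact: comp_polyM. Qed.

Lemma shiftp1 i : shiftp i 1 = 1.
Proof. by rewrite /shiftp -polyC1 comp_polyC. Qed.

Lemma shiftp_id f : shiftp 0 f = f.
Proof. by rewrite /shiftp mulr0z addr0 comp_polyXr. Qed.

Lemma shiftp_comp i j f : shiftp i (shiftp j f) = shiftp (i + j) f.
Proof.
rewrite /shiftp -comp_polyA comp_polyD comp_polyX comp_polyC.
by rewrite intrD polyCD addrA.
Qed.

Lemma sa_mono0 j : sa_mono 0 j = 0.
Proof. by apply/fsfunP => k; rewrite sa_monoE coef_sa0 if_same. Qed.

Lemma sa_monoD t u j : sa_mono (t + u) j = sa_mono t j + sa_mono u j.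
Proof.
by apply/fsfunP => k; rewrite coef_saD !sa_monoE; case: ifP; rewrite ?addr0.
Qed.

Let sum_finsupp (V : nmodType) P (s : {fset int}) (F : int -> V) :
    (supp_S P `<=` s)%fset -> (forall i, P i = 0 -> F i = 0) ->
  \sum_(i <- supp_S P) F i = \sum_(i <- s) F i.
Proof.
move=> sPs F0; apply: big_fset_incl => // i _ /fsfun_dflt; exact: F0.
Qed.

Let mulE P Q (s s' : {fset int}) :
    (supp_S P `<=` s)%fset -> (supp_S Q `<=` s')%fset ->
  sa_mul P Q = \sum_(i <- s) \sum_(j <- s')
                 sa_mono (P i * shiftp i (Q j)) (i + j).
Proof.
move=> sP sQ; rewrite /sa_mul (sum_finsupp sP); last first.
  by move=> i ->; apply: big1 => j _; rewrite mul0r sa_mono0.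
apply: eq_bigr => i _; apply: (sum_finsupp sQ) => j ->.
by rewrite shiftp0 mulr0 sa_mono0.
Qed.

Fact sa_mulDl : left_distributive sa_mul +%R.
Proof.
move=> P Q T; set s := (supp_S P `|` supp_S Q `|` supp_S (P + Q)%R)%fset.
have sP : (supp_S P `<=` s)%fset by rewrite /s -fsetUA fsubsetUl.
have sQ : (supp_S Q `<=` s)%fset.
  by rewrite /s (fsetUC (supp_S P)) -fsetUA fsubsetUl.
have sPQ : (supp_S (P + Q)%R `<=` s)%fset by rewrite /s fsubsetUr.
rewrite !(@mulE _ T s (supp_S T)) // -big_split; apply: eq_bigr => i _ /=.
rewrite -big_split; apply: eq_bigr => j _ /=.
by rewrite coef_saD mulrDl sa_monoD.
Qed.

Fact sa_mulDr : right_distributive sa_mul +%R.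
Proof.
move=> T P Q; set s := (supp_S P `|` supp_S Q `|` supp_S (P + Q)%R)%fset.
have sP : (supp_S P `<=` s)%fset by rewrite /s -fsetUA fsubsetUl.
have sQ : (supp_S Q `<=` s)%fset.
  by rewrite /s (fsetUC (supp_S P)) -fsetUA fsubsetUl.
have sPQ : (supp_S (P + Q)%R `<=` s)%fset by rewrite /s fsubsetUr.
rewrite !(@mulE T _ (supp_S T) s) // -big_split; apply: eq_bigr => i _ /=.
rewrite -big_split; apply: eq_bigr => j _ /=.
by rewrite coef_saD shiftpD mulrDr sa_monoD.
Qed.

Let mul0s P : sa_mul 0 P = 0.
Proof. by apply: (addrI (sa_mul 0 P)); rewrite -sa_mulDl !addr0. Qed.

Let muls0 P : sa_mul P 0 = 0.
Proof. by apply: (addrI (sa_mul P 0)); rewrite -sa_mulDr !addr0. Qed.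

Let mul_suml (I : Type) (r : seq I) (F : I -> shiftalg R) Q :
  sa_mul (\sum_(i <- r) F i) Q = \sum_(i <- r) sa_mul (F i) Q.
Proof. by apply: (big_morph (sa_mul^~ Q)) => // P P'; exact: sa_mulDl. Qed.

Let mul_sumr (I : Type) (r : seq I) (F : I -> shiftalg R) Q :
  sa_mul Q (\sum_(i <- r) F i) = \sum_(i <- r) sa_mul Q (F i).
Proof. by apply: (big_morph (sa_mul Q)) => // P P'; exact: sa_mulDr. Qed.

Lemma sa_mono_sum P : P = \sum_(i <- supp_S P) sa_mono (P i) i.
Proof.
apply/fsfunP => k; rewrite coef_sa_sum.
rewrite (eq_bigr (fun i => if i == k then P k else 0)); last first.
  by move=> i _; rewrite sa_monoE eq_sym; case: eqP => // ->.
rewrite -big_mkcond /=; case: (finsuppP P) => kP.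
  rewrite big_seq_cond big1 // => i /andP[iP /eqP ik].
by rewrite -big_filter filter_pred1_uniq ?fset_uniq // big_seq1.
Qed.

Let finsupp_mono t j : (supp_S (sa_mono t j) `<=` [fset j])%fset.
Proof.
apply/fsubsetP => k; rewrite /supp_S mem_finsupp sa_monoE inE.
by case: ifP; rewrite ?eqxx.
Qed.

Let mul_mono t u i j :
  sa_mul (sa_mono t i) (sa_mono u j) = sa_mono (t * shiftp i u) (i + j).
Proof.
rewrite (mulE (finsupp_mono t i) (finsupp_mono u j)).
by rewrite !big_seq_fset1 !sa_monoE !eqxx.
Qed.

Fact sa_mulA : associative sa_mul.
Proof.
move=> P Q T; rewrite (sa_mono_sum P) !mul_suml; apply: eq_bigr => i _.
rewrite (sa_mono_sum Q) !(mul_suml, mul_sumr); apply: eq_bigr => j _.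
rewrite (sa_mono_sum T) !(mul_suml, mul_sumr); apply: eq_bigr => k _.
by rewrite !mul_mono shiftpM shiftp_comp mulrA addrA.
Qed.

Fact sa_mul1l : left_id (sa_mono 1 0) sa_mul.
Proof.
move=> P; rewrite {1}(sa_mono_sum P) mul_sumr [RHS]sa_mono_sum.
by apply: eq_bigr => i _; rewrite mul_mono mul1r add0r shiftp_id.
Qed.

Fact sa_mul1r : right_id (sa_mono 1 0) sa_mul.
Proof.
move=> P; rewrite {1}(sa_mono_sum P) mul_suml [RHS]sa_mono_sum.
by apply: eq_bigr => i _; rewrite mul_mono shiftp1 mulr1 addr0.
Qed.

Fact sa_oner_neq0 : sa_mono 1 0 != 0.
Proof.
apply/eqP => /fsfunP/(_ 0); rewrite sa_monoE coef_sa0 eqxx.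
by move/eqP; rewrite oner_eq0.
Qed.

HB.instance Definition _ :=
  GRing.Zmodule_isNzRing.Build (shiftalg R)
    sa_mulA sa_mul1l sa_mul1r sa_mulDl sa_mulDr sa_oner_neq0.

(* R[x] as a subalgebra *)
Definition sa_poly f : shiftalg R := sa_mono f 0.
Definition sa_const (c : R) : shiftalg R := sa_poly c%:P.
Definition opS : shiftalg R := sa_mono 1 1.
Definition opSV : shiftalg R := sa_mono 1 (-1).
Definition opD : shiftalg R := opS - 1.
Definition opX : shiftalg R := sa_poly 'X * opSV.

Definition sa_act P f : {poly R} :=
  \sum_(j <- supp_S P) P j * shiftp j f.

(* membership in R[S, S^-1] *)
Definition const_coef P : Prop := forall j, exists c : R, P j = c%:P.

Definition sa_br P Q : shiftalg R := P * Q - Q * P.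

Lemma sa_monoM t u i j :
  sa_mono t i * sa_mono u j = sa_mono (t * shiftp i u) (i + j).
Proof. exact: mul_mono. Qed.

Lemma sa_one : 1 = sa_mono 1 0 :> shiftalg R. Proof. by []. Qed.

Lemma opS_opSV : opS * opSV = 1.
Proof. by rewrite sa_monoM shiftp1 mulr1 sa_one. Qed.

Lemma opSV_opS : opSV * opS = 1.
Proof. by rewrite sa_monoM shiftp1 mulr1 sa_one. Qed.

Lemma opS_x : opS * sa_poly 'X = (sa_poly 'X + 1) * opS.
Proof.
rewrite sa_one /sa_poly -sa_monoD !sa_monoM.
by rewrite shiftp1 mulr1 mul1r /shiftp comp_polyX polyC1.
Qed.

Definition sl2_triple (E H F : shiftalg R) : Prop :=
  [/\ sa_br H E = 2 * E, sa_br H F = - (2 * F) & sa_br E F = H].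

Definition fixed_lowering_triple (E H F : shiftalg R) : Prop :=
  sl2_triple E H F /\ F = 1 - opS.

Definition triple_H (g : shiftalg R) (lambda : R) : shiftalg R :=
  2 * (opX + g) * opD - sa_const lambda.

Definition triple_E (g : shiftalg R) (lambda : R) : shiftalg R :=
  (opX + g) ^+ 2 * opD - sa_const lambda * (opX + g).

(* The parametrization of fixed-lowering triples: E, H, F is the one with
   parameters g in R[S, S^-1] and lambda. *)
Definition fixed_lowering_params (g : shiftalg R) (lambda : R)
    (E H F : shiftalg R) : Prop :=
  [/\ fixed_lowering_triple E H F, const_coef g,
      H = triple_H g lambda & E = triple_E g lambda].

Definition in_L1 (E H F : shiftalg R) : Prop :=
  (supp_S H `<=` [fset -1; 0; 1])%fset /\
  (supp_S E `<=` [fset -2; -1; 0; 1])%fset.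

Definition monic_eigenbasis (H : shiftalg R) (lambda : R)
    (p : nat -> {poly R}) : Prop :=
  forall n, [/\ p n \is monic, size (p n) = n.+1
              & sa_act H (p n) = (n.*2%:R - lambda) *: p n].

End ShiftAlgebra.

Section Consistency.
Variable R : comNzRingType.
Implicit Types (P Q g : shiftalg R) (f : {poly R}).

Lemma sa_act_supp P f (s : {fset int}) : (supp_S P `<=` s)%fset ->
  sa_act P f = \sum_(j <- s) P j * shiftp j f.
Proof.
move=> sPs; apply: big_fset_incl => // j _ /fsfun_dflt ->.
by rewrite mul0r.
Qed.

Lemma sa_act_mono t j f : sa_act (@sa_mono R t j) f = t * shiftp j f.
Proof.
rewrite (@sa_act_supp _ _ [fset j]%fset) ?big_seq_fset1 ?sa_monoE ?eqxx //.
apply/fsubsetP => k; rewrite /supp_S mem_finsupp sa_monoE inE.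
by case: ifP; rewrite ?eqxx.
Qed.

Lemma sa_actDl P Q f : sa_act (P + Q) f = sa_act P f + sa_act Q f.
Proof.
set s := (supp_S P `|` supp_S Q `|` supp_S (P + Q)%R)%fset.
rewrite !(@sa_act_supp _ f s); first last.
- by rewrite /s fsubsetUr.
- by rewrite /s -fsetUA fsubsetUl.
- by rewrite /s (fsetUC (supp_S P)) -fsetUA fsubsetUl.
by rewrite -big_split; apply: eq_bigr => j _; rewrite coef_saD mulrDl.
Qed.

Lemma sa_actDr P f1 f2 : sa_act P (f1 + f2) = sa_act P f1 + sa_act P f2.
Proof.
by rewrite -big_split; apply: eq_bigr => j _; rewrite shiftpD mulrDr.
Qed.

Lemma sa_act0l f : sa_act (0 : shiftalg R) f = 0.
Proof. by apply: big1 => j _; rewrite coef_sa0 mul0r. Qed.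

Lemma sa_act0r P : sa_act P 0 = 0.
Proof. by apply: big1 => j _; rewrite shiftp0 mulr0. Qed.

Let act_suml (I : Type) (r : seq I) (F : I -> shiftalg R) f :
  sa_act (\sum_(i <- r) F i) f = \sum_(i <- r) sa_act (F i) f.
Proof.
by apply: (big_morph (fun P => sa_act P f)) => [P Q|];
  [exact: sa_actDl | exact: sa_act0l].
Qed.

Lemma sa_actM P Q f : sa_act (P * Q) f = sa_act P (sa_act Q f).
Proof.
rewrite (sa_mono_sum P) mulr_suml !act_suml; apply: eq_bigr => i _.
rewrite (sa_mono_sum Q) mulr_sumr !act_suml (big_morph _ (sa_actDr _) (sa_act0r _)).
apply: eq_bigr => j _.
by rewrite sa_monoM !sa_act_mono shiftpM shiftp_comp mulrA.
Qed.

Lemma sa_act1 f : sa_act 1 f = f.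
Proof. by rewrite sa_one sa_act_mono mul1r shiftp_id. Qed.

Lemma opS_comm g : const_coef g -> opS R * g = g * opS R.
Proof.
move=> hg; rewrite (sa_mono_sum g) mulr_sumr mulr_suml.
apply: eq_bigr => j _; have [c ->] := hg j; rewrite !sa_monoM.
by rewrite shiftp1 /shiftp comp_polyC mulr1 mul1r addrC.
Qed.

Lemma sa_const_comm (c : R) P : sa_const c * P = P * sa_const c.
Proof.
rewrite (sa_mono_sum P) mulr_sumr mulr_suml.
apply: eq_bigr => j _; rewrite !sa_monoM /shiftp comp_polyC -/(shiftp 0 _).
by rewrite shiftp_id mulrC addrC.
Qed.

Lemma opD_opX : opD R * opX R = opX R * opD R + 1.
Proof.
rewrite /opD /opX mulrBl mulrBr mul1r mulr1 mulrA opS_x.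
rewrite -!mulrA opS_opSV opSV_opS !mulr1.
by rewrite addrAC.
Qed.

Lemma fixed_lowering_paramsP g lambda : const_coef g ->
  fixed_lowering_params g lambda
    (triple_E g lambda) (triple_H g lambda) (1 - opS R).
Proof.
move=> hg; split => //; split => //.
rewrite /triple_H /triple_E; set c := sa_const _.
have cC P : c * P = P * c by exact: sa_const_comm.
have DY : opD R * (opX R + g) = (opX R + g) * opD R + 1.
  rewrite mulrDr (mulrDl _ g) opD_opX addrAC; congr (_ + _ + _).
  by rewrite /opD mulrBl mulrBr opS_comm // mul1r mulr1.
have -> : 1 - opS R = - opD R by rewrite /opD opprB.
move: (opX R + g) (opD R) DY => Y D DY.
have -> : 2 * Y * D = Y * D + Y * D by rewrite mulr_natl mulr2n mulrDl.
have -> : Y ^+ 2 * D - c * Y = Y * (Y * D - c).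
  by rewrite mulrBr cC expr2 mulrA.
have DZ : D * (Y * D) = Y * D * D + D by rewrite mulrA DY mulrDl mul1r.
have ZY : Y * D * Y = Y * (Y * D) + Y by rewrite -mulrA DY mulrDr mulr1.
have brH P : sa_br (Y * D + Y * D - c) P = 2 * (Y * D * P - P * (Y * D)).
  rewrite /sa_br mulr_natl mulr2n !(mulrBl, mulrBr, mulrDl, mulrDr) cC.
  by rewrite opprB addrA addrNK opprD addrACA.
split.
- have ZC : (Y * D - c) * (Y * D) = Y * D * (Y * D - c).
    by rewrite mulrBl mulrBr cC.
  rewrite brH; congr (2 * _); rewrite mulrA ZY mulrDl -[Y * (_ - c) * _]mulrA.
  by rewrite ZC -[Y * (Y * D) * _]mulrA addrAC subrr add0r.
- rewrite brH -[RHS]mulrN opprK; congr (2 * _).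
  by rewrite mulrN mulNr DZ opprK addrA addNr add0r.
- have ZD : (Y * D - c) * D = D * (Y * D - c) - D.
    by rewrite mulrBl mulrBr DZ cC addrAC addrK.
  rewrite /sa_br mulrN mulNr opprK -[Y * (_ - c) * D]mulrA ZD mulrBr [Y * (D * _)]mulrA.
  rewrite [D * (Y * _)]mulrA DY mulrDl mul1r opprB.
  by rewrite addrA addrNK addrA.
Qed.

End Consistency.

(* y (y - 1) ... (y - k + 1) *)
Definition falling (A : nzRingType) (y : A) (k : nat) : A :=
  \prod_(i < k) (y - i%:R).

(* p_(n - 1), with p_(-1) = 0 *)
Definition seq_pred (A : nmodType) (p : nat -> A) (n : nat) : A :=
  if n is m.+1 then p m else 0.

Definition charlier (R : comNzRingType) (a : R) (n : nat) : {poly R} :=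
  \sum_(k < n.+1) ('C(n, k)%:R * (- a) ^+ (n - k)) *: falling 'X k.

(* Formal power series in z over A, as coefficient sequences. *)
Section FormalSeries.
Variable A : comUnitRingType.

Definition fps_mul (u v : nat -> A) (n : nat) : A :=
  \sum_(k < n.+1) u k * v (n - k)%N.

Definition fps_egf (u : nat -> A) (n : nat) : A := u n / n`!%:R.

(* exp(c z) *)
Definition fps_exp (c : A) : nat -> A := fps_egf (fun n => c ^+ n).

(* (1 + z)^y *)
Definition fps_binpow (y : A) : nat -> A := fps_egf (falling y).

End FormalSeries.

Section Orthogonality.
Variable R : realType.
Local Open Scope classical_set_scope.

Definition measure_support
    (mu : {measure set (measurableTypeR R) -> \bar R}) : set R :=
  [set x | forall U : set R, open U -> U x -> (0 < mu U)%E].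

Definition finite_moments
    (mu : {measure set (measurableTypeR R) -> \bar R}) : Prop :=
  forall n, mu.-integrable setT (fun x : R => (x ^+ n)%:E).

Definition orthogonality_measure (p : nat -> {poly R})
    (mu : {measure set (measurableTypeR R) -> \bar R}) : Prop :=
  [/\ infinite_set (measure_support mu), finite_moments mu
    & forall m n, m != n ->
        (\int[mu]_x ((p m).[x] * (p n).[x])%:E = 0)%E].

End Orthogonality.

(* Main.v *)
(** Writing [Y = X + g], so that [[D, Y] = 1], the eigenbasis is [p_n = Y^n 1]
    and [D p_n = n p_(n-1)].  If [L] is the integral against an orthogonality
    measure, then [L (Y f) = 0] and [L (p_1 f) = a L (D f)] with
    [a = L (p_1 ^ 2) / L 1]; eliminating [x] gives [L (k f) = 0] for
    [k = g + a - (a + beta) S^-1], which commutes with [D], and this forces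
    [k = 0].

    Conversely, for such a [g], [L (Y f) = 0] is Stein's identity
    [L (y f) = a L (S f)], [y = x + a + beta], which characterises the Poisson
    moments and makes [a D] the adjoint of [Y].

    Uniqueness of the measure is obtained without general theory of the moment
    problem.  Stein's identity bounds [L ((y)_N ^ 2)] by [N! (a (1 + a))^N L 1],
    where [(y)_N = y (y - 1) ... (y - N + 1)], while off the naturals [(y)_N ^ 2]
    outgrows [N! B^N] for every [B], so every orthogonality measure is carried by
    the lattice [y = 0, 1, 2, ...].  There [(y)_N >= 0] has integral [a^N L 1],
    which is small enough for suitable polynomials to converge in [L^1] to the
    indicator of a single lattice point; the atoms are therefore determined by
    the moments. *)
Require Import Defs.
From HB Require Import structures.
From mathcomp Require Import all_boot all_order all_algebra.
From mathcomp Require Import finmap.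
From mathcomp Require Import all_classical all_reals all_analysis.
From mathcomp Require Import measurable_realfun ring lra.
Import Order.TTheory GRing.Theory Num.Theory.
Import numFieldNormedType.Exports.
Set Implicit Arguments.
Unset Strict Implicit.
Unset Printing Implicit Defensive.
Local Open Scope classical_set_scope.
Local Open Scope ring_scope.

(** * The action on polynomials *)

Section Action.
Context {R : comNzRingType}.
Implicit Types (P Q : shiftalg R) (f h : {poly R}).

Lemma sa_actZ P c f : sa_act P (c *: f) = c *: sa_act P f.
Proof.
rewrite /sa_act scaler_sumr; apply: eq_bigr => j _.
by rewrite /shiftp comp_polyZ scalerAr.
Qed.

Lemma sa_actNr P f : sa_act P (- f) = - sa_act P f.
Proof. by rewrite -scaleN1r sa_actZ scaleN1r. Qed.

Lemma sa_actNl P f : sa_act (- P) f = - sa_act P f.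
Proof.
by apply/eqP; rewrite -addr_eq0 -sa_actDl addNr sa_act0l.
Qed.

Lemma sa_actBl P Q f : sa_act (P - Q) f = sa_act P f - sa_act Q f.
Proof. by rewrite sa_actDl sa_actNl. Qed.

Lemma sa_actBr P f h : sa_act P (f - h) = sa_act P f - sa_act P h.
Proof. by rewrite sa_actDr sa_actNr. Qed.

Lemma sa_act_suml (I : Type) (r : seq I) (F : I -> shiftalg R) f :
  sa_act (\sum_(i <- r) F i) f = \sum_(i <- r) sa_act (F i) f.
Proof.
exact: (big_morph (fun P => sa_act P f) (fun P Q => sa_actDl P Q f) (sa_act0l f)).
Qed.

Lemma sa_act_const c f : sa_act (sa_const c) f = c *: f.
Proof. by rewrite sa_act_mono shiftp_id mul_polyC. Qed.

Lemma sa_act_nat n f : sa_act n%:R f = n%:R *: f.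
Proof.
elim: n => [|n IHn]; first by rewrite sa_act0l scale0r.
by rewrite -natr1 sa_actDl IHn sa_act1 -natr1 scalerDl scale1r.
Qed.

Lemma sa_act_opS f : sa_act (opS R) f = shiftp 1 f.
Proof. by rewrite sa_act_mono mul1r. Qed.

Lemma sa_act_opSV f : sa_act (opSV R) f = shiftp (-1) f.
Proof. by rewrite sa_act_mono mul1r. Qed.

Lemma sa_act_opD f : sa_act (opD R) f = shiftp 1 f - f.
Proof. by rewrite sa_actBl sa_act_opS sa_act1. Qed.

Lemma sa_act_opX f : sa_act (opX R) f = 'X * shiftp (-1) f.
Proof. by rewrite sa_actM sa_act_opSV sa_act_mono shiftp_id. Qed.

Lemma shiftpC j (c : R) : shiftp j c%:P = c%:P.
Proof. exact: comp_polyC. Qed.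

Lemma shiftpZ j c f : shiftp j (c *: f) = c *: shiftp j f.
Proof. exact: comp_polyZ. Qed.

Lemma horner_shiftp j f x : (shiftp j f).[x] = f.[x + j%:~R].
Proof. by rewrite horner_comp !hornerE. Qed.

Lemma shiftpK j : cancel (@shiftp R j) (shiftp (- j)).
Proof. by move=> f; rewrite shiftp_comp addNr shiftp_id. Qed.

Lemma size_shiftp_le j f : (size (shiftp j f) <= size f)%N.
Proof.
rewrite /shiftp; have [->|f0] := eqVneq f 0; first by rewrite comp_poly0.
have := size_comp_poly_leq f ('X + (j%:~R)%:P).
rewrite size_XaddC muln1 prednK ?size_poly_gt0 //.
Qed.

Lemma size_shiftp j f : size (shiftp j f) = size f.
Proof.
apply/eqP; rewrite eqn_leq size_shiftp_le /=.
by rewrite -{1}(shiftpK j f) size_shiftp_le.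
Qed.

Lemma comm_opD_opXD g : const_coef g ->
  opD R * (opX R + g) = (opX R + g) * opD R + 1.
Proof.
move=> hg; rewrite mulrDr (mulrDl _ g) opD_opX addrAC; congr (_ + _ + _).
by rewrite /opD mulrBl mulrBr opS_comm // mul1r mulr1.
Qed.

Lemma opD_comm g : const_coef g -> opD R * g = g * opD R.
Proof. by move=> hg; rewrite /opD mulrBl mulrBr opS_comm // mul1r mulr1. Qed.

End Action.

Lemma size_sub_lead_coef (R : nzRingType) (n : nat) (f h : {poly R}) :
  size f = n.+1 -> size h = n.+1 -> lead_coef f = lead_coef h ->
  (size (f - h)%R <= n)%N.
Proof.
move=> sf sh fh; apply/leq_sizeP => j; rewrite leq_eqVlt => /predU1P[<-|nj].
  by move: fh; rewrite !lead_coefE sf sh /= coefB => ->; rewrite subrr.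
by rewrite coefB !nth_default ?subrr // ?sf ?sh.
Qed.

(** Subtracting [lead_coef f *: p m] from an [f] of degree [m] lowers its size. The principle serves
    for the powers ['X^n], the eigenbasis and the falling factorials alike. *)
Lemma poly_monic_ind (R : nzRingType) (p : nat -> {poly R})
    (Q : {poly R} -> Prop) :
  (forall n, p n \is monic) -> (forall n, size (p n) = n.+1) ->
  Q 0 -> (forall c f h, Q f -> Q h -> Q (c *: f + h)) -> (forall n, Q (p n)) ->
  forall f, Q f.
Proof.
move=> pm ps Q0 QZD Qp f; have [n] := ubnP (size f).
elim: n f => // n IHn f; rewrite ltnS => fn.
have [->//|f0] := eqVneq f 0.
set m := (size f).-1; set c := lead_coef f.
have sf : size f = m.+1 by rewrite prednK // size_poly_gt0.
rewrite -(subrK (c *: p m) f) addrC; apply: QZD => //; apply: IHn.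
apply: leq_trans fn; rewrite sf ltnS; apply/leq_sizeP => j.
rewrite leq_eqVlt coefB coefZ => /predU1P[<-|mj].
  have -> : (p m)`_m = 1 by rewrite -(eqP (pm m)) lead_coefE ps.
  by rewrite mulr1 subrr.
by rewrite !nth_default ?ps ?sf // mulr0 subrr.
Qed.

Section ActionDomain.
Context {R : idomainType}.
Implicit Types (f : {poly R}).

Lemma lead_coef_shiftp j f : lead_coef (shiftp j f) = lead_coef f.
Proof.
rewrite /shiftp lead_coef_comp; last by rewrite size_XaddC.
by rewrite lead_coefXaddC expr1n mulr1.
Qed.

Lemma size_opD_le f : (size (sa_act (opD R) f) <= (size f).-1)%N.
Proof.
have [->|f0] := eqVneq f 0; first by rewrite sa_act0r size_poly0.
have sf : size f = (size f).-1.+1 by rewrite prednK // size_poly_gt0.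
rewrite sa_act_opD; apply: size_sub_lead_coef => //; first by rewrite size_shiftp.
exact: lead_coef_shiftp.
Qed.

End ActionDomain.

(** * Eigenvectors of [Y D] under [[D, Y] = 1] *)

Section EigenBasis.
Context {R : numDomainType} (Y : shiftalg R).
Hypothesis DY : opD R * Y = Y * opD R + 1.

Let DYE f : sa_act (opD R) (sa_act Y f) = sa_act Y (sa_act (opD R) f) + f.
Proof. by rewrite -sa_actM DY sa_actDl sa_act1 sa_actM. Qed.

(** Since [[D, Y] = 1], [D] carries an eigenvector for [n.+1] to one for [n] and lowers its size. By
    induction [D f = 0], and then [n.+1 *: f = Y (D f) = 0]. *)
Lemma eigen_small_eq0 n (f : {poly R}) : (size f <= n)%N ->
  sa_act Y (sa_act (opD R) f) = n%:R *: f -> f = 0.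
Proof.
elim: n f => [|n IHn] f sf e; first by apply/eqP; rewrite -size_poly_leq0.
have Df0 : sa_act (opD R) f = 0.
  apply: IHn; first by rewrite (leq_trans (size_opD_le f)) //; case: (size f) sf.
  have := congr1 (sa_act (opD R)) e; rewrite DYE sa_actZ.
  by rewrite -natr1 scalerDl scale1r => /addIr.
move/esym: e; rewrite Df0 sa_act0r => /eqP.
by rewrite -mul_polyC mulf_eq0 polyC_eq0 pnatr_eq0 /= => /eqP.
Qed.

Context (p : nat -> {poly R}).
Hypothesis Y_monic : forall n (f : {poly R}), f \is monic -> size f = n.+1 ->
  sa_act Y f \is monic /\ size (sa_act Y f) = n.+2.
Hypotheses (p_monic : forall n, p n \is monic)
  (p_size : forall n, size (p n) = n.+1)
  (p_eigen : forall n, sa_act Y (sa_act (opD R) (p n)) = n%:R *: p n).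

Lemma eigen_basis0 : p 0 = 1.
Proof.
have [c] := size_poly1P _ (introT eqP (p_size 0)).
move=> _ pc; have := p_monic 0; rewrite pc monicE lead_coefC => /eqP ->.
by [].
Qed.

(** Both sides are monic of degree [n.+1] and eigenvectors of [Y D] for [n.+1], so their difference
    is an eigenvector of too small a degree. *)
Lemma eigen_basis_raise n : p n.+1 = sa_act Y (p n).
Proof.
have [Ym Ys] := Y_monic (p_monic n) (p_size n).
apply/eqP; rewrite -subr_eq0; apply/eqP; apply: (@eigen_small_eq0 n.+1).
  apply: size_sub_lead_coef => //.
  by rewrite (eqP Ym) (eqP (p_monic _)).
rewrite !sa_actBr p_eigen DYE sa_actDr p_eigen scalerBr sa_actZ.
by congr (_ - _); rewrite -natr1 scalerDl scale1r.
Qed.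

Lemma eigen_basis_lower n : sa_act (opD R) (p n.+1) = n.+1%:R *: p n.
Proof.
by rewrite eigen_basis_raise DYE p_eigen -natr1 scalerDl scale1r.
Qed.

End EigenBasis.

Section ConstCoef.
Context {R : idomainType}.
Implicit Types (g k : shiftalg R).

Lemma const_coef_mono (c : R) j : const_coef (sa_mono c%:P j).
Proof. by move=> i; rewrite sa_monoE; case: ifP => _; [exists c|exists 0]. Qed.

Lemma const_coefD g k : const_coef g -> const_coef k -> const_coef (g + k).
Proof.
move=> hg hk j; rewrite coef_saD; have [c ->] := hg j; have [d ->] := hk j.
by exists (c + d); rewrite polyCD.
Qed.

Lemma const_coefN g : const_coef g -> const_coef (- g).
Proof.
by move=> hg j; rewrite coef_saN; have [c ->] := hg j; exists (- c); rewrite polyCN.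
Qed.

Lemma sa_const_opSV (c : R) : sa_const c * opSV R = sa_mono c%:P (-1).
Proof. by rewrite sa_monoM shiftp1 mulr1 add0r. Qed.

Lemma const_coef_act_size g (f : {poly R}) :
  const_coef g -> (size (sa_act g f) <= size f)%N.
Proof.
move=> hg; rewrite /sa_act; apply: (big_ind (fun h : {poly R} => (size h <= size f)%N)).
- by rewrite size_poly0.
- by move=> h1 h2 s1 s2; rewrite (leq_trans (size_polyD _ _)) // geq_max s1.
- move=> j _; have [c ->] := hg j; rewrite mul_polyC.
  by rewrite (leq_trans (size_scale_leq _ _)) // size_shiftp_le.
Qed.

(** The leading term comes from [x f(x - 1)] alone: an operator with constant coefficients does not
    raise the degree. *)
Lemma raising_monic g n (f : {poly R}) : const_coef g ->
  f \is monic -> size f = n.+1 ->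
  sa_act (opX R + g) f \is monic /\ size (sa_act (opX R + g) f) = n.+2.
Proof.
move=> hg fm fs; rewrite sa_actDl sa_act_opX.
have hm : shiftp (-1) f \is monic.
  by rewrite monicE lead_coef_shiftp.
have hs : size ('X * shiftp (-1) f) = n.+2.
  by rewrite mulrC size_mulX ?monic_neq0 // size_shiftp fs.
have gs : (size (sa_act g f) < size ('X * shiftp (-1) f)%R)%N.
  by rewrite hs ltnS (leq_trans (const_coef_act_size _ hg)) // fs.
rewrite size_polyDl // hs; split=> //.
by rewrite monicE lead_coefDl // lead_coef_monicM ?monicX // (eqP hm).
Qed.

(** The terms in [lambda] cancel. The factor 2 stays on both sides because an integral domain may
    have characteristic 2; it is cancelled in [monic_eigenbasisP]. *)
Lemma triple_H_eigen g lambda (f : {poly R}) n :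
  sa_act (triple_H g lambda) f = (n.*2%:R - lambda) *: f ->
  2 * sa_act (opX R + g) (sa_act (opD R) f) = 2 * (n%:R *: f).
Proof.
rewrite /triple_H sa_actBl sa_act_const scalerBl => /addIr.
move: (opX R + g) => Y; rewrite -mulrA mulr_natl mulr2n sa_actDl sa_actM => e.
by rewrite mulr_natl mulr2n e mulr_natl scalerMnl -mulrnA muln2.
Qed.

End ConstCoef.

(** * Faithfulness of the action *)

Section Faithful.
Context {R : numDomainType}.

(** A 1-periodic [f] takes the value [f.[0]] at every natural number, so [f - f.[0]] has more roots
    than its size allows. *)
Lemma opD_act_eq0 (f : {poly R}) : sa_act (opD R) f = 0 -> f = (f.[0])%:P.
Proof.
rewrite sa_act_opD => /eqP; rewrite subr_eq0 => /eqP f1.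
have fn n : f.[n%:R] = f.[0].
  by elim: n => // n <-; rewrite -[in RHS]f1 horner_shiftp -natr1.
apply/eqP; rewrite -subr_eq0; apply/eqP; set h := f - _.
apply: (@roots_geq_poly_eq0 _ h [seq i%:R | i <- iota 0 (size h)]).
- apply/allP => _ /mapP[i _ ->].
  by rewrite rootE /h hornerD hornerN hornerC fn subrr.
- rewrite map_inj_uniq ?iota_uniq // => i j /eqP.
  by rewrite eqr_nat => /eqP.
- by rewrite size_map size_iota.
Qed.

(* Evaluating at 0 reads [\sum_i c_i f(i)]; a Lagrange-type polynomial [f]
   isolates one coefficient. *)
Lemma const_coef_act_eq0 (k : shiftalg R) : const_coef k ->
  (forall f, sa_act k f = 0) -> k = 0.
Proof.
move=> hk k0; apply/fsfunP => j; rewrite coef_sa0.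
case: (finsuppP k) => // jk; have [c kj] := hk j.
pose f : {poly R} := \prod_(i <- supp_S k | i != j) ('X - (i%:~R)%:P).
have := congr1 (fun h => h.[0]) (k0 f); rewrite /= horner0 /sa_act horner_sum.
rewrite (bigD1_seq j) ?fset_uniq //= big1_seq => [|i /andP[ij ik]]; last first.
  rewrite hornerM horner_shiftp /f horner_prod; apply/eqP.
  rewrite mulf_eq0 prodf_seq_eq0; apply/orP; right; apply/hasP; exists i => //.
  by rewrite ij /= add0r !hornerE subrr.
rewrite addr0 kj hornerM horner_shiftp hornerC add0r => /eqP.
rewrite mulf_eq0 => /orP[/eqP->//|]; rewrite horner_prod.
rewrite prodf_seq_eq0 => /hasP[i _ /andP[ij]].
by rewrite !hornerE subr_eq0 eqr_int eq_sym (negbTE ij).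
Qed.

End Faithful.

Section Functional.
Context {R : numFieldType} (L : {poly R} -> R).
Hypothesis L_lin : forall c f h, L (c *: f + h) = c * L f + L h.

Lemma functional0 : L 0 = 0.
Proof.
have := L_lin 1 0 0; rewrite scaler0 addr0 mul1r => e.
by apply: (addIr (L 0)); rewrite add0r -e.
Qed.

Lemma functionalZ c f : L (c *: f) = c * L f.
Proof. by rewrite -[c *: f]addr0 L_lin functional0 addr0. Qed.

Lemma functionalD f h : L (f + h) = L f + L h.
Proof. by rewrite -[f]scale1r L_lin mul1r scale1r. Qed.

Lemma functionalB f h : L (f - h) = L f - L h.
Proof. by rewrite addrC -scaleN1r L_lin mulN1r addrC. Qed.

End Functional.

(** * Recovering [g] from the orthogonality functional *)

Section Recovery.
Context {R : numFieldType} (g : shiftalg R) (p : nat -> {poly R})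
  (L : {poly R} -> R).
Hypotheses (g_const : const_coef g)
  (p_monic : forall n, p n \is monic) (p_size : forall n, size (p n) = n.+1)
  (p_raise : forall n, p n.+1 = sa_act (opX R + g) (p n))
  (p_lower : forall n, sa_act (opD R) (p n.+1) = n.+1%:R *: p n)
  (p0 : p 0 = 1).
Hypotheses (L_lin : forall c f h, L (c *: f + h) = c * L f + L h)
  (L1 : L 1 != 0).

Let pInd (Q : {poly R} -> Prop) := @poly_monic_ind R p Q p_monic p_size.

Lemma raising_functional_eq0 : (forall n, L (p n.+1) = 0) ->
  forall f, L (sa_act (opX R + g) f) = 0.
Proof.
move=> Lp; apply: pInd => [|c f h Lf Lh|n]; last by rewrite -p_raise.
  by rewrite sa_act0r functional0.
by rewrite sa_actDr sa_actZ L_lin Lf Lh mulr0 addr0.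
Qed.

(** As [k] commutes with [D], induction on [n] gives [D (k p_n) = 0], so [k p_n] is a constant [c].
    Then [c * L 1 = 0] forces [c = 0], and [k] kills every polynomial. *)
Lemma functional_annihilator_eq0 (k : shiftalg R) : const_coef k ->
  (forall f, L (sa_act k f) = 0) -> k = 0.
Proof.
move=> hk Lk; apply: const_coef_act_eq0 => //; apply: pInd.
- exact: sa_act0r.
- by move=> c f h kf kh; rewrite sa_actDr sa_actZ kf kh scaler0 addr0.
have cst n : sa_act (opD R) (sa_act k (p n)) = 0 -> sa_act k (p n) = 0.
  move=> /opD_act_eq0 e; have := Lk (p n); rewrite e -alg_polyC.
  rewrite functionalZ // => /eqP.
  by rewrite mulf_eq0 (negbTE L1) orbF => /eqP ->; rewrite scale0r.
elim=> [|n IHn]; apply: cst; rewrite -sa_actM opD_comm // sa_actM.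
  by rewrite p0 sa_act_opD shiftp1 subrr sa_act0r.
by rewrite p_lower sa_actZ IHn scaler0.
Qed.

Lemma orthogonal_param s : p 1 = 'X + s%:P ->
  (forall n, L (p n.+1) = 0) -> (forall n, L (p 1 * p n.+2) = 0) ->
  let a := L (p 1 * p 1) / L 1 in
  g = - sa_const a + sa_const (a + s) * opSV R.
Proof.
move=> p1 Lp Lp1 a.
(* Checked on the basis: at [p 1] it is the definition of [a], and at every other [p n] both sides
   vanish by orthogonality. *)
have L1f f : L (p 1 * f) = a * L (sa_act (opD R) f).
  move: f; apply: pInd => [|c f h Lf Lh|[|[|n]]].
  - by rewrite sa_act0r mulr0 functional0 // mulr0.
  - rewrite mulrDr -scalerAr L_lin Lf Lh sa_actDr sa_actZ L_lin.
    by rewrite mulrDr [a * (c * _)]mulrCA.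
  - by rewrite p0 mulr1 sa_act_opD shiftp1 subrr Lp functional0 // mulr0.
  - by rewrite p_lower p0 scale1r divfK.
  - by rewrite p_lower Lp1 functionalZ // Lp !mulr0.
have LY := raising_functional_eq0 Lp.
suff : g + sa_const a - sa_const (a + s) * opSV R = 0.
  by move/eqP; rewrite subr_eq0 => /eqP <-; rewrite addrC addrK.
apply: functional_annihilator_eq0.
  rewrite sa_const_opSV; apply: const_coefD.
    by apply: const_coefD => //; exact: const_coef_mono.
  by apply: const_coefN; exact: const_coef_mono.
(* Both identities contain [L ('X * shiftp (-1) f)]: one from [p 1 = 'X + s], the other from the
   summand [X] of [Y]. Eliminating it leaves an operator with constant coefficients. *)
move=> f; have := LY f; have := L1f (shiftp (-1) f).
rewrite sa_act_opD shiftp_comp subrr shiftp_id functionalB // p1 mulrDl.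
rewrite mul_polyC functionalD // functionalZ // sa_actDl sa_act_opX functionalD //.
move=> e1 e2; rewrite sa_actBl sa_actDl sa_actM !sa_act_const sa_act_opSV.
rewrite functionalB // functionalD // !functionalZ //.
have -> : L (sa_act g f) = - L ('X * shiftp (-1) f).
  by apply/eqP; rewrite -addr_eq0 addrC e2.
have -> : L ('X * shiftp (-1) f) = a * (L f - L (shiftp (-1) f)) - s * L (shiftp (-1) f).
  by rewrite -e1 addrK.
by ring.
Qed.

End Recovery.

(** * Falling factorials and Charlier polynomials *)

Section Falling.
Context {R : comNzRingType} (b : R).

Lemma fallingSr (A : nzRingType) (y : A) n :
  falling y n.+1 = falling y n * (y - n%:R).
Proof. by rewrite /falling big_ord_recr. Qed.

Lemma fallingSl (A : nzRingType) (y : A) n :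
  falling y n.+1 = y * falling (y - 1) n.
Proof.
rewrite /falling big_ord_recl subr0; congr (_ * _); apply: eq_bigr => i _.
by rewrite /bump /= natrD opprD addrA.
Qed.

Lemma rmorph_falling (A B : nzRingType) (h : {rmorphism A -> B}) y n :
  h (falling y n) = falling (h y) n.
Proof.
by rewrite rmorph_prod; apply: eq_bigr => i _; rewrite rmorphB rmorph_nat.
Qed.

Lemma shiftp_falling j n :
  shiftp j (falling ('X + b%:P) n) = falling ('X + b%:P + j%:~R) n.
Proof.
rewrite /shiftp; have := rmorph_falling (comp_poly ('X + (j%:~R)%:P)) ('X + b%:P) n.
move=> ->; congr falling.
by rewrite [LHS]comp_polyD comp_polyX comp_polyC addrAC (rmorph_int polyC).
Qed.

Lemma horner_falling n x : (falling ('X + b%:P) n).[x] = falling (x + b) n.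
Proof.
by rewrite -[LHS]/(horner_eval x _) rmorph_falling /= /horner_eval !hornerE.
Qed.

Lemma opD_falling n : sa_act (opD R) (falling ('X + b%:P) n.+1) =
  n.+1%:R *: falling ('X + b%:P) n.
Proof.
rewrite sa_act_opD shiftp_falling fallingSl fallingSr addrK.
by rewrite -mul_polyC polyC_natr -natr1 mulr1z; ring.
Qed.

End Falling.

Lemma falling_monic (R : comNzRingType) (b : R) n :
  falling ('X + b%:P) n \is monic.
Proof.
apply: monic_prod => i _; rewrite -addrA -polyC_natr -polyCN -polyCD.
exact: monicXaddC.
Qed.

Lemma size_falling (R : comNzRingType) (b : R) n :
  size (falling ('X + b%:P) n) = n.+1.
Proof.
elim: n => [|n IHn]; first by rewrite /falling big_ord0 size_poly1.
rewrite fallingSr -addrA -polyC_natr -polyCN -polyCD.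
by rewrite size_Mmonic ?monicXaddC ?monic_neq0 ?falling_monic // IHn size_XaddC addn2.
Qed.

Lemma falling_nat (A : nzRingType) k n : falling (k%:R : A) n = (k ^_ n)%:R.
Proof.
elim: n => [|n IHn]; first by rewrite /falling big_ord0.
rewrite fallingSr IHn ffactnSr natrM.
by have [nk|/ffact_small ->] := leqP n k; [rewrite natrB|rewrite !mul0r].
Qed.

Section CharlierRaising.
Context {R : comNzRingType} (a beta : R).
Let y : {poly R} := 'X + (a + beta)%:P.
Let g := - sa_const a + sa_const (a + beta) * opSV R.

Lemma charlier_raising f :
  sa_act (opX R + g) f = y * shiftp (-1) f - a *: f.
Proof.
rewrite /g !sa_actDl sa_actNl sa_act_opX sa_actM !sa_act_const sa_act_opSV.
by rewrite addrCA addrC /y mulrDl mul_polyC.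
Qed.

Lemma charlier_raising_falling n :
  sa_act (opX R + g) (falling y n) = falling y n.+1 - a *: falling y n.
Proof. by rewrite charlier_raising shiftp_falling -fallingSl. Qed.

(** [X + g] is the sum of the scalar [- a] and [W], which commute, so the binomial theorem applies.
    [W] acts by [f |-> y f(x - 1)], hence [W ^+ k] sends 1 to the falling factorial of [y]. *)
Lemma charlier_raising_iter n :
  sa_act ((opX R + g) ^+ n) 1 = charlier a n \Po y.
Proof.
pose W := opX R + sa_const (a + beta) * opSV R.
have WE k : sa_act (W ^+ k) 1 = falling y k.
  elim: k => [|k IHk]; first by rewrite expr0 sa_act1 /falling big_ord0.
  rewrite exprS sa_actM IHk; apply: (addIr (- a *: falling y k)).
  rewrite scaleNr -charlier_raising_falling -sa_act_const -sa_actBl.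
  by congr sa_act; rewrite /W /g -addrA [_ * _ - _]addrC.
have -> : opX R + g = - sa_const a + W by rewrite /W /g addrCA.
have cC : GRing.comm (- sa_const a) W.
  by rewrite /GRing.comm mulNr mulrN sa_const_comm.
rewrite exprDn_comm // sa_act_suml /charlier linear_sum /=.
apply: eq_bigr => k _; rewrite comp_polyZ.
have -> : falling 'X k \Po y = falling y k.
  by have := rmorph_falling (comp_poly y) 'X k; rewrite /= comp_polyX.
rewrite -mulr_natl -(WE k) sa_actM.
have -> : (- sa_const a) ^+ (n - k) = sa_const ((- a) ^+ (n - k)) :> shiftalg R.
  elim: (n - k)%N => [|m IHm]; first by rewrite !expr0.
  rewrite !exprS IHm; apply/eqP; rewrite mulNr eq_sym -subr_eq0 opprK.
  by rewrite /sa_const /sa_poly sa_monoM shiftpC addr0 -sa_monoD -polyCM -polyCD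
    mulNr addNr sa_mono0.
by rewrite sa_actM sa_act_const sa_act_nat scalerA.
Qed.

End CharlierRaising.

Lemma charlier_egf (R : numFieldType) (a : R) (y : {poly R}) (n : nat) :
  fps_egf (fun n => charlier a n \Po y) n =
  fps_mul (fps_exp (- a)%:P) (fps_binpow y) n.
Proof.
(* [fps_egf] divides inside [{poly R}], where [^-1] is a true inverse only on units; factorials are
   nonzero constants. *)
have fact_unit m : (m`!%:R : {poly R}) \is a GRing.unit.
  by rewrite -polyC_natr poly_unitE size_polyC coefC unitfE pnatr_eq0 -lt0n fact_gt0.
rewrite /fps_egf /fps_mul /charlier linear_sum /= mulr_suml.
(* The Charlier sum is indexed by the degree of the falling factorial, the Cauchy product by the
   exponent of [- a]; reversal matches them, and [n! = C(n, k) k! (n - k)!] does the rest. *)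
rewrite [RHS](reindex_inj rev_ord_inj) /=; apply: eq_bigr => k _.
have kn : (k <= n)%N by rewrite -ltnS.
rewrite subSS subKn // comp_polyZ.
have -> : falling 'X k \Po y = falling y k.
  by have := rmorph_falling (comp_poly y) 'X k; rewrite /= comp_polyX.
rewrite /fps_exp /fps_binpow /fps_egf -(bin_fact kn) !natrM.
rewrite -mul_polyC polyCM polyC_natr polyC_exp.
have binU : ('C(n, k)%:R : {poly R}) \is a GRing.unit.
  by rewrite -polyC_natr poly_unitE size_polyC coefC unitfE pnatr_eq0 -lt0n bin_gt0 kn.
rewrite invrM ?unitrM ?fact_unit // invrM ?fact_unit //.
rewrite [LHS](_ : _ = 'C(n, k)%:R * 'C(n, k)%:R^-1 *
   ((- a)%:P ^+ (n - k) / (n - k)`!%:R * (falling y k / k`!%:R))).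
  by rewrite divrr // mul1r.
by ring.
Qed.

(** * Stein's identity *)

Section Stein.
Context {R : numFieldType} (a beta : R) (L : {poly R} -> R).
Hypothesis L_lin : forall c f h, L (c *: f + h) = c * L f + L h.
Let y : {poly R} := 'X + (a + beta)%:P.
Let Y := opX R + (- sa_const a + sa_const (a + beta) * opSV R).
Hypothesis LY : forall f, L (sa_act Y f) = 0.

(** [L (Y (f * S h)) = 0] reads [L (y * (S^-1 f) * h) = a * L (f * S h)]; subtracting
    [a * L (f * h)] gives the claim. *)
Lemma stein_adjoint f h : L (sa_act Y f * h) = a * L (f * sa_act (opD R) h).
Proof.
have := LY (f * shiftp 1 h).
rewrite !charlier_raising sa_act_opD -/y shiftpM shiftp_comp addNr shiftp_id.
rewrite functionalB // functionalZ // mulrA => /eqP; rewrite subr_eq0 => /eqP e.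
rewrite mulrBl functionalB // e mulrBr functionalB // -scalerAl functionalZ //.
by rewrite mulrBr.
Qed.

(** [Y + a] raises [falling y n] to [falling y n.+1], and its adjoint is [a (D + 1) = a S]. *)
Lemma stein_falling n h :
  L (falling y n * h) = a ^+ n * L (shiftp n%:Z h).
Proof.
elim: n h => [|n IHn] h; first by rewrite /falling big_ord0 mul1r expr0 mul1r shiftp_id.
have -> : falling y n.+1 = sa_act Y (falling y n) + a *: falling y n.
  by rewrite charlier_raising_falling subrK.
rewrite mulrDl functionalD // stein_adjoint -scalerAl functionalZ //.
rewrite -mulrDr -functionalD // -mulrDr sa_act_opD subrK IHn shiftp_comp.
by rewrite mulrA -exprS -addn1 PoszD.
Qed.

Lemma stein_falling1 n : L (falling y n) = a ^+ n * L 1.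
Proof. by rewrite -[falling y n]mulr1 stein_falling shiftp1. Qed.

(** Each [Y] stripped from the factor of higher index becomes [a D] on the other one, which is
    exhausted first because [D p_0 = 0]. *)
Lemma stein_orthogonal (p : nat -> {poly R}) m n :
  p 0 = 1 -> (forall n, p n.+1 = sa_act Y (p n)) ->
  (forall n, sa_act (opD R) (p n.+1) = n.+1%:R *: p n) ->
  m != n -> L (p m * p n) = 0.
Proof.
move=> p0 p_raise p_lower.
suff lt_mn i j : (i < j)%N -> L (p j * p i) = 0.
  by rewrite neq_ltn => /orP[mn|nm]; [rewrite mulrC|]; exact: lt_mn.
elim: j i => // j IHj [|i] ij; rewrite p_raise stein_adjoint.
  by rewrite p0 sa_act_opD shiftp1 subrr mulr0 functional0 // mulr0.
by rewrite p_lower -scalerAr functionalZ // IHj // !mulr0.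
Qed.

(* [L (S^n (falling y m))] obeys the Pascal-type recursion
   [u n.+1 m.+1 = u n m.+1 + (m + 1) u n m]; multiplying by [a ^+ n] turns
   the resulting bound into an induction without division. *)
Lemma stein_shift_falling_le n m : 0 <= a -> 0 <= L 1 ->
  a ^+ n * L (shiftp n%:Z (falling y m)) <= L 1 * m`!%:R * a ^+ m * (1 + a) ^+ n.
Proof.
move=> a0 L0; elim: n m => [|n IHn] m.
  rewrite shiftp_id stein_falling1 !expr0 mul1r mulr1 mulrC.
  rewrite -mulrA ler_wpM2l // ler_peMl ?exprn_ge0 //.
  by rewrite ler1n fact_gt0.
case: m => [|m].
  rewrite /falling big_ord0 shiftp1 mulrC fact0 expr0 !mulr1.
  by rewrite ler_wpM2l // lerXn2r ?nnegrE ?addr_ge0 // lerDr.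
have -> : shiftp n.+1%:Z (falling y m.+1) =
    shiftp n%:Z (falling y m.+1) + m.+1%:R *: shiftp n%:Z (falling y m).
  rewrite -shiftpZ -opD_falling -shiftpD sa_act_opD addrC subrK.
  by rewrite shiftp_comp addrC -intS.
rewrite functionalD // functionalZ // mulrDr.
have -> : L 1 * m.+1`!%:R * a ^+ m.+1 * (1 + a) ^+ n.+1 =
   a * (L 1 * m.+1`!%:R * a ^+ m.+1 * (1 + a) ^+ n) +
   a * m.+1%:R * (L 1 * m`!%:R * a ^+ m * (1 + a) ^+ n).
  by rewrite factS natrM !exprS; ring.
apply: lerD.
  by rewrite exprS -mulrA ler_wpM2l.
by rewrite mulrCA exprS [X in X <= _](_ : _ = a * m.+1%:R *
     (a ^+ n * L (shiftp n%:Z (falling y m)))) ?ler_wpM2l ?mulr_ge0 //; ring.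
Qed.

(** One factor of the square is traded for [a ^+ n S^n] by [stein_falling]; the diagonal case
    [m = n] of the previous bound remains. *)
Lemma stein_falling_sqr_le n : 0 <= a -> 0 <= L 1 ->
  L (falling y n ^+ 2) <= L 1 * n`!%:R * (a * (1 + a)) ^+ n.
Proof.
move=> a0 L0; rewrite expr2 stein_falling exprMn mulrA.
exact: stein_shift_falling_le.
Qed.

End Stein.

(** * Measures with given polynomial moments *)

Section RealFalling.
Context {R : realType}.

(* The normalised squares [w N] eventually increase, since their ratio
   [(t - N) ^+ 2 / (N.+1 * B)] tends to infinity. *)
Lemma falling_sqr_lower (t B : R) : 0 < B -> (forall k : nat, t != k%:R) ->
  exists m : nat, forall N, (m <= N)%N ->
    m.+1%:R^-1 <= falling t N ^+ 2 / (N`!%:R * B ^+ N).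
Proof.
move=> B0 tN; pose w N := falling t N ^+ 2 / (N`!%:R * B ^+ N).
have w0 N : 0 < w N.
  apply: divr_gt0; last by rewrite mulr_gt0 ?ltr0n ?fact_gt0 ?exprn_gt0.
  rewrite lt_neqAle sqr_ge0 andbT eq_sym sqrf_eq0 prodf_seq_neq0.
  by apply/allP => i _ /=; rewrite subr_eq0.
have wS N : w N.+1 = w N * ((t - N%:R) ^+ 2 / (N.+1%:R * B)).
  have u0 : N.+1%:R != 0 :> R by rewrite pnatr_eq0.
  have f0 : N`!%:R != 0 :> R by rewrite pnatr_eq0 -lt0n fact_gt0.
  have c0 : B ^+ N != 0 by rewrite expf_neq0 ?gt_eqF.
  have B_neq0 : B != 0 by rewrite gt_eqF.
  rewrite /w fallingSr factS natrM [B ^+ N.+1]exprS.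
  move: (N.+1%:R) (N`!%:R) (B ^+ N) u0 f0 c0 => u f c u0 f0 c0.
  by field; rewrite u0 f0 c0 B_neq0.
(* For [N >= n0] one has [N - t >= N / 2] and [N > 8 B], so [(t - N) ^+ 2 >= N ^+ 2 / 4 >= 2 N B >=
   (N + 1) B], and the ratio is at least 1. *)
pose n0 := (Num.truncn (2 * `|t| + 8 * B)).+1.
have n0P : 2 * `|t| + 8 * B < n0%:R by rewrite truncnS_gt.
have mono N : (n0 <= N)%N -> w n0 <= w N.
  elim: N => [|N IHN]; first by rewrite leqn0 => /eqP ->.
  rewrite leq_eqVlt => /predU1P[->//|]; rewrite ltnS => nN.
  apply: (le_trans (IHN nN)); rewrite wS -[leLHS]mulr1 ler_pM2l //.
  rewrite ler_pdivlMr ?mulr_gt0 // mul1r.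
  have NP : 2 * `|t| + 8 * B < N%:R by rewrite (lt_le_trans n0P) // ler_nat.
  have tt : t <= `|t| by exact: ler_norm.
  have t0 : 0 <= `|t| by [].
  have N1 : 1 <= N%:R :> R by rewrite ler1n (leq_trans _ nN).
  rewrite -natr1; nra.
(* The second entry of the maximum ensures [m.+1%:R^-1 <= w n0]. *)
exists (maxn n0 (Num.truncn (w n0)^-1)) => N; rewrite geq_max => /andP[nN _].
apply: le_trans (mono _ nN); rewrite -[leRHS]invrK lef_pV2 ?posrE ?invr_gt0 ?ltr0n //.
rewrite (le_trans (ltW (truncnS_gt _))) // ler_nat ltnS leq_maxr //.
Qed.

End RealFalling.

Section Moments.
Context {R : realType}.
Implicit Types (mu nu : {measure set (measurableTypeR R) -> \bar R})
  (f h : {poly R}).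

Definition moment_functional mu f : R := \int[mu]_x f.[x].

Lemma integrable_horner (p : nat -> {poly R}) mu f :
  (forall n, p n \is monic) -> (forall n, size (p n) = n.+1) ->
  (forall n, mu.-integrable setT (fun x => (p n).[x]%:E)) ->
  mu.-integrable setT (fun x => f.[x]%:E).
Proof.
move=> pm ps ip; move: f; apply: (poly_monic_ind pm ps) => // [|c f h fi hi].
  by apply: (eq_integrable measurableT (cst 0%E)) => [x _|]; rewrite ?horner0 //;
    exact: integrable0.
have := integrableD measurableT (integrableZl measurableT c fi) hi.
by apply: eq_integrable => // x _; rewrite /= !hornerE.
Qed.

Lemma finite_moments_integrable mu f : finite_moments mu ->
  mu.-integrable setT (fun x => f.[x]%:E).
Proof.
move=> fm; apply: (@integrable_horner (fun n => 'X^n)) => [n|n|n].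
- exact: monicXn.
- exact: size_polyXn.
- by apply: (eq_integrable measurableT _ _ _ (fm n)) => x _; rewrite !hornerE.
Qed.

Lemma moment_functional_lin mu : finite_moments mu -> forall c f h,
  moment_functional mu (c *: f + h) =
    c * moment_functional mu f + moment_functional mu h.
Proof.
move=> fm c f h; rewrite /moment_functional.
have fi k := finite_moments_integrable k fm.
have ci : mu.-integrable setT (EFin \o (fun x => c * f.[x])).
  exact: (integrableZl measurableT c (fi f)).
have := RintegralD measurableT ci (fi h); rewrite RintegralZl //; last exact: (fi f).
move=> <-.
by apply: eq_Rintegral => x _; rewrite !hornerE.
Qed.

Lemma finite_moments_fin mu A : finite_moments mu -> measurable A ->
  mu A \is a fin_num.
Proof.
move=> fm mA; rewrite ge0_fin_numE //.
apply: (@le_lt_trans _ _ (mu setT)); first by rewrite le_measure ?inE.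
have /integrableP[_] := finite_moments_integrable 1 fm.
by under eq_integral do rewrite hornerE abse1; rewrite integral_cst // mul1e.
Qed.

Lemma finite_set_roots f : f != 0 -> finite_set [set x | root f x].
Proof.
move=> f0; apply: contrapT => /(infinite_set_fset (size f))[B Bf sB].
have : (size (enum_fset B) < size f)%N.
  by apply: max_poly_roots (fset_uniq B) => //; apply/allP => x xB; exact: Bf.
by rewrite ltnNge sB.
Qed.

(** If the integral of [f ^+ 2] were zero, the open set where [f] is nonzero would be null, so the
    support would lie in the finite root set of [f]. *)
Lemma moment_functional_sqr_gt0 mu f : finite_moments mu ->
  infinite_set (measure_support mu) -> f != 0 ->
  0 < moment_functional mu (f ^+ 2).
Proof.
move=> fm infS f0; rewrite lt_neqAle; apply/andP; split; last first.
  by apply: Rintegral_ge0 => x _; rewrite hornerE sqr_ge0.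
apply: contra_notN infS => /eqP/esym I0.
have : (\int[mu]_x `|(f ^+ 2).[x]%:E| = 0)%E.
  under eq_integral => x _ do rewrite gee0_abs ?lee_fin ?horner_exp ?sqr_ge0 // -horner_exp.
  rewrite -[LHS]fineK; first by rewrite [fine _]I0.
  by apply: integrable_fin_num => //; exact: finite_moments_integrable.
have /integrableP[mf2 _] := finite_moments_integrable (f ^+ 2) fm.
move=> /(ae_eq_integral_abs mu measurableT mf2)[N [mN N0 subN]].
apply: sub_finite_set (finite_set_roots f0) => x xS /=.
apply: contrapT => /negP fx0.
have fopen : open [set x : measurableTypeR R | f.[x] != 0].
  rewrite [X in open X](_ : _ = horner f @^-1` [set y | y != 0]) //.
  by apply: open_comp => [y _|]; [exact: continuous_horner|exact: open_neq].
suff mu0 : mu [set x | f.[x] != 0] = 0%E by have := xS _ fopen fx0; rewrite mu0 ltxx.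
apply: (@subset_measure0 _ _ _ mu _ N) => //.
  rewrite [X in measurable X](_ : _ = setT `&` horner f @^-1` (~` [set 0])).
    by apply: (measurable_poly f measurableT); apply: measurableC; exact: measurable_set1.
  by apply/seteqP; split=> y /=; [move/eqP|move=> [_ /eqP]].
move=> y /= fy0; apply: subN => /= /(_ I).
by rewrite hornerE => -[] /eqP; rewrite sqrf_eq0 (negbTE fy0).
Qed.

End Moments.

(** * Concentration on a shifted lattice *)

Section Concentration.
Context {R : realType}.
Implicit Types (mu nu : {measure set (measurableTypeR R) -> \bar R})
  (f h : {poly R}).

Definition shifted_nat (b : R) : set (measurableTypeR R) :=
  [set k%:R - b | k in [set: nat]].

Lemma measurable_shifted_nat b : measurable (shifted_nat b).
Proof.
apply: countable_measurable => [t|]; first exact: measurable_set1.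
exact: card_image_le.
Qed.

Lemma geometric_le_eq0 (r C : R) (m : nat) : 0 <= r ->
  (forall N, (m <= N)%N -> r * 2 ^+ N <= C) -> r = 0.
Proof.
move=> r0 rC; apply/eqP; rewrite eq_sym -[_ == _]negbK; apply/negP => rn0.
have rp : 0 < r by rewrite lt_neqAle rn0.
pose N := maxn m (Num.trunc (C / r)).+1.
have := rC N (leq_maxl _ _); apply/negP; rewrite -ltNge mulrC -ltr_pdivrMr //.
apply: (lt_trans (truncnS_gt _)); apply: (@le_lt_trans _ _ N%:R).
  by rewrite ler_nat leq_maxr.
by rewrite -natrX ltr_nat ltn_expl.
Qed.

(** By [falling_sqr_lower] the complement of the lattice is covered by the sets [A m], on which all
    normalised squares with [N >= m] are at least [m.+1%:R^-1]. Their integrals tend to zero, so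
    each [A m] is null. *)
Lemma concentrated_shifted_nat mu (b C B : R) : finite_moments mu -> 0 < B ->
  (forall N, moment_functional mu (falling ('X + b%:P) N ^+ 2) <=
     C * N`!%:R * B ^+ N) ->
  mu (~` shifted_nat b) = 0%E.
Proof.
move=> fm B0 LN.
(* The pointwise lower bound holds for any positive base; taking [2 * B] makes the integral of [q N]
   at most [C / 2 ^+ N]. *)
pose q N x := falling (x + b) N ^+ 2 / (N`!%:R * (2 * B) ^+ N).
have d0 N : 0 < N`!%:R * (2 * B) ^+ N.
  by rewrite mulr_gt0 ?ltr0n ?fact_gt0 ?exprn_gt0 ?mulr_gt0.
have q0 N x : 0 <= q N x by rewrite divr_ge0 ?sqr_ge0 // ltW.
pose fq N : {poly R} := (N`!%:R * (2 * B) ^+ N)^-1 *: falling ('X + b%:P) N ^+ 2.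
have qE N x : q N x = (fq N).[x].
  by rewrite hornerZ horner_exp horner_falling mulrC.
pose A m := \bigcap_(N in [set N | (m <= N)%N]) [set x | m.+1%:R^-1 <= q N x].
have mS m N : measurable [set x : measurableTypeR R | m.+1%:R^-1 <= q N x].
  rewrite [X in measurable X](_ : _ = setT `&` horner (fq N) @^-1` `[m.+1%:R^-1, +oo[).
    exact: measurable_poly.
  by apply/seteqP; split=> x /=; rewrite in_itv /= andbT qE // => -[].
have mA m : measurable (A m) by apply: bigcap_measurableType => N _; exact: mS.
apply: measure_negligible.
  by apply: measurableC; exact: measurable_shifted_nat.
apply: (@negligibleS _ _ _ mu (\bigcup_m A m)).
  move=> x nx.
  have tN k : x + b != k%:R.
    by apply/eqP => xk; apply: nx; exists k => //; rewrite -xk addrK.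
  have [m mP] := falling_sqr_lower (mulr_gt0 (@ltr0Sn R 1) B0) tN.
  by exists m => // N /= mN; exact: mP.
apply: negligible_bigcup => m; apply/negligibleP; first exact: mA.
have muA := finite_moments_fin fm (mA m).
suff A0 : fine (mu (A m)) = 0 by move: (fineK muA); rewrite A0 => /esym.
apply: (@geometric_le_eq0 _ (m.+1%:R * C) m); first exact: fine_ge0.
move=> N mN.
have -> : fine (mu (A m)) * 2 ^+ N = m.+1%:R * 2 ^+ N * (m.+1%:R^-1 * fine (mu (A m))).
  have : m.+1%:R != 0 :> R by rewrite pnatr_eq0.
  by move: (m.+1%:R) => u u0; field.
rewrite -mulrA ler_pM2l ?ltr0n // mulrC -ler_pdivlMr ?exprn_gt0 //.
(* Markov's inequality on [A m], with the moment of [fq N] as the middle term. *)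
apply: (@le_trans _ _ (moment_functional mu (fq N))); last first.
  rewrite -[fq N]addr0 moment_functional_lin // [X in _ + X]functional0; last first.
    exact: moment_functional_lin.
  rewrite addr0 mulrC ler_pdivrMr //; apply: (le_trans (LN N)).
  rewrite exprMn [X in _ <= X](_ : _ = C * N`!%:R * B ^+ N) //.
  have : 2 ^+ N != 0 :> R by rewrite expf_neq0.
  by move: (2 ^+ N) => u u0; field.
rewrite -lee_fin EFinM (fineK muA).
rewrite [leRHS]fineK; last first.
  by apply: integrable_fin_num => //; exact: finite_moments_integrable.
rewrite -integral_cst; last exact: mA.
have /integrableP[mfq _] := finite_moments_integrable (fq N) fm.
apply: (@le_trans _ _ (\int[mu]_(x in A m) (fq N).[x]%:E)%E).
  apply: ge0_le_integral => //.
  - exact: mA.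
  - by move=> x _; rewrite /= lee_fin invr_ge0.
  - by apply: (measurable_funS measurableT _ mfq).
  - by move=> x Ax; rewrite /= lee_fin -qE; exact: Ax.
apply: ge0_subset_integral => //; first exact: mA.
by move=> x _; rewrite lee_fin -qE.
Qed.

End Concentration.

(** * Atoms of a lattice measure from its moments *)

Section Atoms.
Context {R : realType}.
Implicit Types (mu nu : {measure set (measurableTypeR R) -> \bar R}).

Lemma falling_add (A : nzRingType) (y : A) m n :
  falling y (m + n) = falling y m * falling (y - m%:R) n.
Proof.
elim: n => [|n IHn]; first by rewrite addn0 [falling _ 0]/falling big_ord0 mulr1.
by rewrite addnS !fallingSr IHn mulrA natrD opprD addrA.
Qed.

Lemma falling_nat_ge0 (i n : nat) : 0 <= falling (i%:R : R) n.
Proof. by rewrite falling_nat. Qed.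

Lemma fallingN1 (A : comNzRingType) n : falling (-1 : A) n = (-1) ^+ n * n`!%:R.
Proof.
elim: n => [|n IHn]; first by rewrite /falling big_ord0 mulr1.
by rewrite fallingSr IHn factS natrM exprS -natr1; ring.
Qed.

(* On the naturals (shifted by [- b]) this polynomial is 1 at [k] and vanishes
   at the other points below [k + 1 + M]. *)
Definition atom_poly (b : R) (k M : nat) : {poly R} :=
  ((-1) ^+ M / (k`!%:R * M`!%:R)) *:
    (falling ('X + b%:P) k * falling ('X + (b - k.+1%:R)%:P) M).

(** For [i < k] the first factor vanishes. For [i > k], [falling_add] splits the right side into the
    two factors of [atom_poly] and an extra [i - k >= 1]. At [i = k] the normalisation is exact,
    since [falling (-1) M = (-1) ^+ M * M!]. *)
Lemma atom_poly_dist b k M i :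
  `|(atom_poly b k M).[i%:R - b] - (i == k)%:R| <=
  (k`!%:R * M`!%:R)^-1 * (falling ('X + b%:P) (k.+1 + M)).[i%:R - b].
Proof.
have d0 : 0 < k`!%:R * M`!%:R :> R by rewrite mulr_gt0 // ltr0n fact_gt0.
rewrite /atom_poly hornerZ hornerM !horner_falling subrK addrA subrK.
have [ik|ki|->] := ltngtP i k.
- rewrite falling_nat ffact_small // mul0r mulr0 subr0 normr0.
  by rewrite mulr_ge0 ?falling_nat_ge0 // invr_ge0 ltW.
- rewrite subr0 -mulrA normrM normrX normrN1 expr1n mul1r normrM.
  rewrite [X in X * _]gtr0_norm ?invr_gt0 // ler_pM2l ?invr_gt0 //.
  rewrite falling_add fallingSr -mulrA -natrB // normrM !ger0_norm ?falling_nat_ge0 //.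
  rewrite ler_wpM2l ?falling_nat_ge0 // ler_peMl ?falling_nat_ge0 //.
  by rewrite -natrB ?(ltnW ki) // ler1n subn_gt0.
- have -> : k%:R - k.+1%:R = -1 :> R by rewrite -natr1 opprD addrA subrr add0r.
  rewrite falling_nat ffactnn fallingN1.
  rewrite [X in `|X|](_ : _ = 0) ?normr0 ?mulr_ge0 ?falling_nat_ge0 ?invr_ge0 ?ltW //.
  have k0 : k`!%:R != 0 :> R by rewrite pnatr_eq0 -lt0n fact_gt0.
  have M0 : M`!%:R != 0 :> R by rewrite pnatr_eq0 -lt0n fact_gt0.
  have : (-1) ^+ M * (-1) ^+ M = 1 :> R by rewrite -expr2 sqrr_sign.
  move: (k`!%:R) (M`!%:R) ((-1) ^+ M) k0 M0 => u v s u0 v0 ss.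
  rewrite mulr1n; transitivity (s * s * (u / u) * (v / v) - 1).
    by field; rewrite u0 v0.
  by rewrite ss !divff // !mulr1 subrr.
Qed.

Lemma moment_functional_restr mu b f : finite_moments mu ->
  mu (~` shifted_nat b) = 0%E ->
  moment_functional mu f = \int[mu]_(x in shifted_nat b) f.[x].
Proof.
move=> fm mu0; rewrite /moment_functional /Rintegral.
rewrite (negligible_integral _ _ _ mu0) // ?setTD ?setCK //.
  by apply: measurableC; exact: measurable_shifted_nat.
exact: finite_moments_integrable.
Qed.

Lemma moment_atom_cvg mu (a b : R) k : finite_moments mu ->
  mu (~` shifted_nat b) = 0%E ->
  (forall n, moment_functional mu (falling ('X + b%:P) n) =
     a ^+ n * moment_functional mu 1) ->
  moment_functional mu (atom_poly b k M) @[M --> \oo] -->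
    fine (mu [set k%:R - b]).
Proof.
move=> fm mu0 La; set D := shifted_nat b; set x0 := k%:R - b.
have mD : measurable D by exact: measurable_shifted_nat.
have mx0 : measurable [set x0 : measurableTypeR R] by exact: measurable_set1.
have fD f : mu.-integrable D (EFin \o horner f).
  apply: (integrableS measurableT mD) => //; exact: finite_moments_integrable.
pose u : measurableTypeR R -> R := \1_[set x0].
have uD : mu.-integrable D (EFin \o u).
  apply: (le_integrable mD _ _ (fD 1)).
    by apply/measurable_EFinP; exact: measurable_indic.
  by move=> x _ /=; rewrite hornerE lee_fin normr1 /u indicE; case: (_ \in _);
    rewrite ?normr1 ?normr0.
have u0 : fine (mu [set x0]) = \int[mu]_(x in D) u x.
  rewrite /Rintegral integral_indic // setIidl // => _ ->.
  by exists k.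
(* This is the integral of the bound in [atom_poly_dist]; it tends to zero with [a ^+ M / M!]. *)
pose e M : R := a ^+ k.+1 * moment_functional mu 1 / k`!%:R * exp_coeff a M.
have dist M : `|moment_functional mu (atom_poly b k M) - fine (mu [set x0])| <= e M.
  have -> : e M = moment_functional mu ((k`!%:R * M`!%:R)^-1 *:
      falling ('X + b%:P) (k.+1 + M)).
    rewrite functionalZ; last exact: moment_functional_lin.
    have k0 : k`!%:R != 0 :> R by rewrite pnatr_eq0 -lt0n fact_gt0.
    have M0 : M`!%:R != 0 :> R by rewrite pnatr_eq0 -lt0n fact_gt0.
    rewrite La /e /exp_coeff exprD /=.
    move: (k`!%:R) (M`!%:R) (a ^+ k.+1) (a ^+ M) k0 M0 => p q r s p0 q0.
    by field; rewrite p0 q0.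
  (* Integrals are restricted to the lattice, where the pointwise bound is available. *)
  rewrite u0 !(moment_functional_restr _ fm mu0) -/D.
  rewrite -RintegralB //.
  apply: (le_trans (le_normr_Rintegral _ _)) => //.
    exact: (integrableB mD (fD _) uD).
  apply: le_Rintegral => //.
    exact: (integrable_abse (integrableB mD (fD _) uD)).
  move=> _ [i _ <-]; rewrite [leRHS]hornerZ.
  suff -> : u (i%:R - b) = (i == k)%:R by exact: atom_poly_dist.
  rewrite /u indicE; have [->|ik] := eqVneq i k; first by rewrite mem_set.
  by rewrite memNset // => /= /addIr/eqP; rewrite eqr_nat (negbTE ik).
have e0 : e M @[M --> \oo] --> 0.
  rewrite -(mulr0 (a ^+ k.+1 * moment_functional mu 1 / k`!%:R)).
  by apply: cvgMr; exact: cvg_exp_coeff.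
apply/cvgrPdist_le => eps eps0.
move/cvgrPdist_le : e0 => /(_ _ eps0); apply: filterS => M.
rewrite sub0r normrN => eM; rewrite distrC.
by rewrite (le_trans (dist M)) // (le_trans (ler_norm _)).
Qed.

Lemma concentrated_sum mu b A : mu (~` shifted_nat b) = 0%E -> measurable A ->
  mu A = (\sum_(0 <= k <oo) mu (A `&` [set (k%:R - b)%R]))%E.
Proof.
move=> mu0 mA; have mD := measurable_shifted_nat b.
have mAk k : measurable (A `&` [set k%:R - b] : set (measurableTypeR R)).
  by apply: measurableI => //; exact: measurable_set1.
rewrite (measureDI mu mA mD) [X in (X + _)%E](_ : _ = 0%E) ?add0e; last first.
  apply: (@subset_measure0 _ _ _ mu _ (~` shifted_nat b)) => //.
  - exact: measurableD.
  - exact: measurableC.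
have -> : A `&` shifted_nat b = \bigcup_k (A `&` [set k%:R - b]).
  apply/seteqP; split => [x [Ax [k _ kx]]|x [k _ [Ax kx]]].
    by exists k => //; split.
  by split=> //; exists k => //; rewrite kx.
have triv : trivIset [set: nat] (fun k => A `&` [set k%:R - b]).
  move=> i j _ _ [x [[_ ->] [_ /eqP]]].
  by rewrite (inj_eq (addIr _)) eqr_nat => /eqP.
apply: etrans (measure_bigcup mu _ _ (fun k _ => mAk k) triv) _.
by apply: eq_eseriesl => k; exact: in_setT.
Qed.

(** The moments of [atom_poly b k M] under [mu] converge both to the atom of [mu] and to [c] times
    the atom of [nu]; atoms determine measures carried by the lattice. *)
Lemma moment_proportional_measure mu nu (a b c : R) :
  finite_moments mu -> finite_moments nu ->
  mu (~` shifted_nat b) = 0%E -> nu (~` shifted_nat b) = 0%E ->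
  (forall n, moment_functional nu (falling ('X + b%:P) n) =
     a ^+ n * moment_functional nu 1) ->
  (forall f, moment_functional mu f = c * moment_functional nu f) ->
  forall A, measurable A -> mu A = (c%:E * nu A)%E.
Proof.
move=> fmu fnu mu0 nu0 La Lc A mA.
have atom k : mu [set k%:R - b] = (c%:E * nu [set (k%:R - b)%R])%E.
  have mk : measurable [set k%:R - b : measurableTypeR R] by exact: measurable_set1.
  rewrite -(fineK (finite_moments_fin fmu mk)) -(fineK (finite_moments_fin fnu mk)).
  rewrite -EFinM; congr EFin.
  have La' n : moment_functional mu (falling ('X + b%:P) n) =
      a ^+ n * moment_functional mu 1.
    by rewrite !Lc La mulrCA.
  have h1 := @moment_atom_cvg mu a b k fmu mu0 La'.
  have h2 : moment_functional mu (atom_poly b k M) @[M --> \oo] -->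
      c * fine (nu [set (k%:R - b)%R]).
    under eq_fun do rewrite Lc.
    by apply: cvgMr; exact: (@moment_atom_cvg nu a b k fnu nu0 La).
  by rewrite -(cvg_lim (@Rhausdorff R) h1) -(cvg_lim (@Rhausdorff R) h2).
rewrite (concentrated_sum mu0 mA) (concentrated_sum nu0 mA) -nneseriesZl //.
apply: eq_eseriesr => k _; have [Ak|nAk] := pselect (A (k%:R - b)).
  by rewrite setIidr ?atom // => _ ->.
suff -> : A `&` [set k%:R - b] = set0 by rewrite !measure0 mule0.
by apply/seteqP; split=> // x [Ax xk]; apply: nAk; rewrite -xk.
Qed.

End Atoms.

(** * The Poisson measure *)

Section PoissonLine.
Context {R : realType} (a b : R).
Hypothesis a0 : 0 < a.
Let y : {poly R} := 'X + b%:P.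

Definition poisson_atom (k : nat) : {measure set (measurableTypeR R) -> \bar R} :=
  mscale (NngNum (poisson_pmf_ge0 a k)) (\d_(k%:R - b : measurableTypeR R)).

(** The Poisson law transported to the line by [k |-> k - b], written as a series of Dirac masses so
    that its integrals become series. *)
Definition poisson_line : {measure set (measurableTypeR R) -> \bar R} :=
  mseries poisson_atom 0.

Lemma poisson_lineE A : poisson_line A =
  (\sum_(0 <= k <oo) (poisson_pmf a k)%:E * \d_((k%:R - b)%R : measurableTypeR R) A)%E.
Proof. by []. Qed.

Lemma ge0_integral_poisson_line (f : measurableTypeR R -> \bar R) :
  measurable_fun setT f -> (forall x, (0 <= f x)%E) ->
  (\int[poisson_line]_x f x =
   \sum_(0 <= k <oo) (poisson_pmf a k)%:E * f (k%:R - b)%R)%E.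
Proof.
move=> mf f0; rewrite ge0_integral_measure_series //.
apply: eq_eseriesr => k _; rewrite ge0_integral_mscale // integral_dirac //.
by rewrite diracT mul1e.
Qed.

Lemma poisson_line_shifted_natC : poisson_line (~` shifted_nat b) = 0%E.
Proof.
rewrite poisson_lineE eseries0 // => k _ _.
by rewrite diracE memNset ?mule0 // => /(_ (ex_intro2 _ _ k I erefl)).
Qed.

Lemma poisson_line_atom k :
  poisson_line [set k%:R - b] = (poisson_pmf a k)%:E.
Proof.
rewrite poisson_lineE (@nneseriesD1 _ _ k) // => [|i _]; last first.
  by rewrite mule_ge0 // lee_fin poisson_pmf_ge0.
rewrite eseries0 ?adde0; first by rewrite diracE mem_set // mule1.
move=> i _ /andP[_ ik]; rewrite diracE memNset ?mule0 // => /= /addIr/eqP.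
by rewrite eqr_nat (negbTE ik).
Qed.

Lemma poisson_pmf_sum : (\sum_(0 <= k <oo) (poisson_pmf a k)%:E = 1)%E.
Proof.
have : poisson_prob a 0 setT = 1%E by exact: probability_setT.
rewrite /poisson_prob a0 => <-.
by rewrite nneseries_esumT // => k; rewrite lee_fin poisson_pmf_ge0.
Qed.

Lemma poisson_pmf_falling n k :
  poisson_pmf a (k + n) * ((k + n) ^_ n)%:R = a ^+ n * poisson_pmf a k.
Proof.
have := ffact_fact (leq_addl k n); rewrite addnK => /(congr1 (fun m => m%:R : R)).
rewrite natrM => e; rewrite /poisson_pmf a0 -e exprD.
have k0 : k`!%:R != 0 :> R by rewrite pnatr_eq0 -lt0n fact_gt0.
have f0 : ((k + n) ^_ n)%:R != 0 :> R.
  by rewrite pnatr_eq0 -lt0n ffact_gt0 leq_addl.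
move: (k`!%:R) (((k + n) ^_ n)%:R) k0 f0 => u v u0 v0.
by field; rewrite u0 v0.
Qed.

(** Terms with [k < n] vanish; after reindexing by [k + n] the falling factorial cancels into the
    factorial, leaving [a ^+ n] times the total mass. *)
Lemma poisson_pmf_falling_sum n :
  (\sum_(0 <= k <oo) (poisson_pmf a k)%:E * (k ^_ n)%:R%:E = (a ^+ n)%:E)%E.
Proof.
have t0 k : (0 <= (poisson_pmf a k)%:E * (k ^_ n)%:R%:E)%E.
  by rewrite mule_ge0 // lee_fin poisson_pmf_ge0.
rewrite (@nneseries_split _ _ 0 n) // add0n big_nat_cond big1 ?add0e; last first.
  by move=> k /andP[/andP[_ kn] _]; rewrite ffact_small // mule0.
rewrite -nneseries_addn //.
under eq_eseriesr => k _ do rewrite -EFinM poisson_pmf_falling EFinM.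
rewrite nneseriesZl ?poisson_pmf_sum ?mule1 // => k _.
by rewrite lee_fin poisson_pmf_ge0.
Qed.

(** With the absolute value, one computation gives integrability and also the factorial moments,
    because [falling y n] is nonnegative on the lattice. *)
Lemma integral_abs_falling n :
  (\int[poisson_line]_x `|(falling y n).[x]%:E| = (a ^+ n)%:E)%E.
Proof.
rewrite ge0_integral_poisson_line //; last first.
  apply: measurableT_comp => //; apply/measurable_EFinP; exact: measurable_poly.
rewrite -poisson_pmf_falling_sum; apply: eq_eseriesr => k _.
by rewrite horner_falling subrK falling_nat /= ger0_norm.
Qed.

Lemma finite_moments_poisson_line : finite_moments poisson_line.
Proof.
move=> n.
have := @integrable_horner _ (falling y) poisson_line ('X^n) (falling_monic b)
  (size_falling b).
have fi m : poisson_line.-integrable setT (fun x => (falling y m).[x]%:E).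
  apply/integrableP; split; last by rewrite integral_abs_falling ltry.
  by apply/measurable_EFinP; exact: measurable_poly.
move=> /(_ fi); apply: eq_integrable => // x _.
by rewrite !hornerE.
Qed.

Lemma poisson_line_falling n : moment_functional poisson_line (falling y n) = a ^+ n.
Proof.
have fm := finite_moments_poisson_line.
have mD := measurable_shifted_nat b.
rewrite (moment_functional_restr _ fm poisson_line_shifted_natC).
have := congr1 fine (integral_abs_falling n); rewrite /= => <-.
rewrite (negligible_integral _ _ _ poisson_line_shifted_natC) //; last 2 first.
- exact: measurableC.
- exact: (integrable_abse (finite_moments_integrable _ fm)).
rewrite setTD setCK; congr fine; apply: eq_integral => x /set_mem[k _ <-].
by rewrite horner_falling subrK falling_nat /= ger0_norm.
Qed.

Lemma infinite_support_poisson_line : infinite_set (measure_support poisson_line).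
Proof.
pose x (k : nat) : R := k%:R - b.
have xS k : measure_support poisson_line (x k).
  move=> U oU Ux; apply: (@lt_le_trans _ _ (poisson_line [set x k])).
    rewrite poisson_line_atom lte_fin /poisson_pmf a0.
    by rewrite !mulr_gt0 ?exprn_gt0 ?invr_gt0 ?ltr0n ?fact_gt0 ?expR_gt0.
  by apply: le_measure; rewrite ?inE; [exact: measurable_set1|
    exact: open_measurable|move=> _ ->].
move=> fS; apply: infinite_nat.
rewrite (_ : setT = x @^-1` measure_support poisson_line); last first.
  by apply/seteqP; split=> // k _; exact: xS.
apply: finite_preimage fS => i j _ _ /addIr/eqP.
by rewrite eqr_nat => /eqP.
Qed.

End PoissonLine.

(** * Supports *)

Lemma supp_SP (R : comNzRingType) (P : shiftalg R) (s : {fset int}) :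
  reflect (forall k, k \notin s -> P k = 0) (supp_S P `<=` s)%fset.
Proof.
apply: (iffP (@fsubsetP _ _ _)) => [sP k ks|P0 k].
  by case: (finsuppP P) => // /sP; rewrite (negbTE ks).
by rewrite /supp_S mem_finsupp; apply: contraNT => /P0 ->.
Qed.

Lemma supp_SD (R : comNzRingType) (P Q : shiftalg R) (s : {fset int}) :
  (supp_S P `<=` s)%fset -> (supp_S Q `<=` s)%fset ->
  (supp_S (P + Q)%R `<=` s)%fset.
Proof.
move=> /supp_SP sP /supp_SP sQ; apply/supp_SP => k ks.
by rewrite coef_saD sP // sQ // addr0.
Qed.

Lemma supp_SN (R : comNzRingType) (P : shiftalg R) (s : {fset int}) :
  (supp_S P `<=` s)%fset -> (supp_S (- P)%R `<=` s)%fset.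
Proof.
by move=> /supp_SP sP; apply/supp_SP => k ks; rewrite coef_saN sP // oppr0.
Qed.

Lemma supp_S_mono (R : comNzRingType) (t : {poly R}) j (s : {fset int}) :
  j \in s -> (supp_S (sa_mono t j) `<=` s)%fset.
Proof.
move=> js; apply/supp_SP => k; rewrite sa_monoE; case: eqP => // ->.
by rewrite js.
Qed.

Lemma supp_SM (R : comNzRingType) (P Q : shiftalg R) (s s' u : {fset int}) :
  (supp_S P `<=` s)%fset -> (supp_S Q `<=` s')%fset ->
  (forall i j, i \in s -> j \in s' -> i + j \in u) ->
  (supp_S (P * Q)%R `<=` u)%fset.
Proof.
move=> /fsubsetP sP /fsubsetP sQ ss'; apply/supp_SP => k ku.
have -> : P * Q = \sum_(i <- supp_S P) \sum_(j <- supp_S Q)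
     sa_mono (P i * shiftp i (Q j)) (i + j) by [].
rewrite coef_sa_sum big1_seq // => i /= iP; rewrite coef_sa_sum big1_seq // => j /= jQ.
rewrite sa_monoE; case: eqP => // kij; case/negP: ku.
by rewrite kij; apply: ss'; [exact: sP|exact: sQ].
Qed.

(** Shift exponents add under products: [X + g] uses only -1 and 0, and [D] only 0 and 1. *)
Lemma charlier_in_L1 (R : comNzRingType) (c d lambda : R) :
  let g := sa_const c + sa_const d * opSV R in
  in_L1 (triple_E g lambda) (triple_H g lambda) (1 - opS R).
Proof.
move=> g; have sD : (supp_S (opD R) `<=` [fset 0; 1])%fset.
  by apply: supp_SD; [|apply: supp_SN]; apply: supp_S_mono; rewrite !inE.
have sY : (supp_S (opX R + g)%R `<=` [fset -1; 0])%fset.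
  by apply: supp_SD; [|apply: supp_SD]; rewrite /opX ?sa_monoM ?add0r;
    apply: supp_S_mono; rewrite !inE.
have s2 : (supp_S (2 : shiftalg R) `<=` [fset 0])%fset.
  by apply: supp_SD; apply: supp_S_mono; rewrite !inE.
have sc : (supp_S (sa_const lambda) `<=` [fset 0])%fset.
  by apply: supp_S_mono; rewrite !inE.
have s2Y : (supp_S (2 * (opX R + g))%R `<=` [fset -1; 0])%fset.
  apply: (supp_SM s2 sY) => i j; rewrite !inE => /eqP ->.
  by move=> /orP[]/eqP ->.
have sYY : (supp_S ((opX R + g) ^+ 2)%R `<=` [fset -2; -1; 0])%fset.
  rewrite expr2; apply: (supp_SM sY sY) => i j; rewrite !inE.
  by move=> /orP[]/eqP -> /orP[]/eqP ->.
split.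
  apply: supp_SD.
    apply: (supp_SM s2Y sD) => i j; rewrite !inE.
    by move=> /orP[]/eqP -> /orP[]/eqP ->.
  by apply: supp_SN; apply: supp_S_mono; rewrite !inE.
apply: supp_SD.
  apply: (supp_SM sYY sD) => i j; rewrite !inE.
  by move=> /orP[/orP[]|]/eqP -> /orP[]/eqP ->.
apply: supp_SN; apply: (supp_SM sc sY) => i j; rewrite !inE => /eqP ->.
by move=> /orP[]/eqP ->.
Qed.

(** * Orthogonality of the eigenbasis *)

Section Structure.
Context {R : numDomainType} (g : shiftalg R) (lambda : R) (p : nat -> {poly R}).
Hypotheses (g_const : const_coef g)
  (hp : monic_eigenbasis (triple_H g lambda) lambda p).

Lemma monic_eigenbasisP : [/\ forall n, p n \is monic,
  forall n, size (p n) = n.+1, p 0 = 1,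
  forall n, p n.+1 = sa_act (opX R + g) (p n)
  & forall n, sa_act (opD R) (p n.+1) = n.+1%:R *: p n].
Proof.
have pm n : p n \is monic by have [] := hp n.
have ps n : size (p n) = n.+1 by have [] := hp n.
have pe n : sa_act (opX R + g) (sa_act (opD R) (p n)) = n%:R *: p n.
  have [_ _ /triple_H_eigen] := hp n; apply: mulfI.
  by rewrite -polyC_natr polyC_eq0 pnatr_eq0.
have DY := comm_opD_opXD g_const.
have Ym n (f : {poly R}) := @raising_monic _ g n f g_const.
split=> //.
- exact: (eigen_basis0 pm ps).
- exact: (eigen_basis_raise DY Ym pm ps pe).
- exact: (eigen_basis_lower DY Ym pm ps pe).
Qed.

End Structure.

Section OrthogonalityMeasures.
Context {R : realType}.
Implicit Types (mu nu : {measure set (measurableTypeR R) -> \bar R}).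

Lemma orthogonality_functional p mu m n : orthogonality_measure p mu ->
  m != n -> moment_functional mu (p m * p n) = 0.
Proof.
move=> [_ _ orth] /orth; rewrite /moment_functional /Rintegral.
by under [in X in _ -> X]eq_integral do rewrite hornerM; move=> ->.
Qed.

Lemma orthogonality_mass p mu : orthogonality_measure p mu ->
  0 < moment_functional mu 1.
Proof.
move=> [infS fm _]; have := moment_functional_sqr_gt0 fm infS (oner_neq0 _).
by rewrite expr1n.
Qed.

Lemma orthogonality_param (g : shiftalg R) lambda p mu : const_coef g ->
  monic_eigenbasis (triple_H g lambda) lambda p -> orthogonality_measure p mu ->
  exists a beta : R, 0 < a /\
    g = - sa_const a + sa_const (a + beta) * opSV R.
Proof.
move=> g_const hp orth; have [pm ps p0 praise plower] := monic_eigenbasisP g_const hp.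
have [infS fm _] := orth; have L1 := orthogonality_mass orth.
have Lp n : moment_functional mu (p n.+1) = 0.
  by rewrite -[p n.+1]mulr1 -p0; exact: orthogonality_functional.
have p1 : p 1 = 'X + ((p 1)`_0)%:P.
  apply/polyP => -[|[|i]]; rewrite !coefE /= ?add0r ?addr0 //.
    by have := pm 1; rewrite monicE lead_coefE ps => /eqP.
  by rewrite nth_default // ps.
(* [a] is the squared norm of [p 1] relative to the mass, hence positive; [beta] is the constant
   term of [p 1]. *)
exists (moment_functional mu (p 1 * p 1) / moment_functional mu 1), (p 1)`_0.
split.
  by rewrite divr_gt0 // -expr2 moment_functional_sqr_gt0 // monic_neq0.
apply: (orthogonal_param g_const pm ps praise plower p0) => //.
- exact: moment_functional_lin.
- by rewrite gt_eqF.
- by move=> n; exact: orthogonality_functional.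
Qed.

(** * Consequences of the Charlier form of [g] *)

Section Charlier.
Variables (a beta : R) (p : nat -> {poly R}).
Let g := - sa_const a + sa_const (a + beta) * opSV R.
Let y : {poly R} := 'X + (a + beta)%:P.
Hypotheses (a0 : 0 < a) (p0 : p 0 = 1)
  (p_monic : forall n, p n \is monic) (p_size : forall n, size (p n) = n.+1)
  (p_raise : forall n, p n.+1 = sa_act (opX R + g) (p n))
  (p_lower : forall n, sa_act (opD R) (p n.+1) = n.+1%:R *: p n).

Let P := poisson_line a (a + beta).

(** On falling factorials the claim is [a ^+ n.+1 - a * a ^+ n = 0]. *)
Lemma poisson_line_stein f : moment_functional P (sa_act (opX R + g) f) = 0.
Proof.
have lin := moment_functional_lin (finite_moments_poisson_line (a + beta) a0).
move: f; apply: (poly_monic_ind (falling_monic (a + beta)) (size_falling (a + beta))).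
- by rewrite sa_act0r functional0.
- by move=> c f h Lf Lh; rewrite sa_actDr sa_actZ lin Lf Lh mulr0 addr0.
- move=> n; rewrite charlier_raising_falling functionalB // functionalZ //.
  by rewrite !poisson_line_falling // -exprS subrr.
Qed.

Lemma poisson_line_orthogonality : orthogonality_measure p P.
Proof.
have fm := finite_moments_poisson_line (a + beta) a0.
split=> //; first exact: infinite_support_poisson_line.
move=> m n mn.
have L0 := stein_orthogonal (moment_functional_lin fm) poisson_line_stein
  p0 p_raise p_lower mn.
under eq_integral do rewrite -hornerM.
rewrite -[LHS]fineK; first by congr EFin.
by apply: integrable_fin_num => //; exact: finite_moments_integrable.
Qed.

(** Stein's identity for [mu] gives both its concentration on the lattice and its factorial moments
    [a ^+ n * L 1], which are [L 1] times those of [P]. *)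
Lemma orthogonality_measure_poisson mu : orthogonality_measure p mu ->
  forall A, measurable A -> mu A = ((moment_functional mu 1)%:E * P A)%E.
Proof.
move=> orth; have [_ fm _] := orth; have L1 := orthogonality_mass orth.
have lin := moment_functional_lin fm.
have Lp n : moment_functional mu (p n.+1) = 0.
  by rewrite -[p n.+1]mulr1 -p0; exact: orthogonality_functional.
have LY := raising_functional_eq0 p_monic p_size p_raise lin Lp.
have fmP := finite_moments_poisson_line (a + beta) a0.
have linP := moment_functional_lin fmP.
apply: (moment_proportional_measure (a := a) (b := a + beta)) => //.
- apply: (concentrated_shifted_nat (B := a * (1 + a)) fm).
    by rewrite mulr_gt0 // addr_gt0.
  by move=> N; apply: stein_falling_sqr_le => //; exact: ltW.
- exact: poisson_line_shifted_natC.
- have := poisson_line_falling (a + beta) a0 0.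
  rewrite [falling _ 0]/falling big_ord0 expr0 => P1 n.
  by rewrite poisson_line_falling // P1 mulr1.
apply: (poly_monic_ind (falling_monic (a + beta)) (size_falling (a + beta))).
- by rewrite !functional0 // mulr0.
- by move=> c f h Lf Lh; rewrite lin linP Lf Lh mulrDr mulrCA.
- by move=> n; rewrite poisson_line_falling // (stein_falling1 lin LY) mulrC.
Qed.

(** [Y (S p_n)] is computed twice: as [Y p_n + Y D p_n = p_(n+1) + n p_n], and as [y p_n - a S p_n]
    with [S p_n = p_n + n p_(n-1)]. *)
Lemma charlier_recurrence n : 'X * p n =
  p n.+1 + (n%:R - beta) *: p n + (a * n%:R) *: seq_pred p n.
Proof.
have Dp : sa_act (opD R) (p n) = n%:R *: seq_pred p n.
  case: n => [|n]; last exact: p_lower.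
  by rewrite p0 sa_act_opD shiftp1 subrr scale0r.
have YDp : sa_act (opX R + g) (sa_act (opD R) (p n)) = n%:R *: p n.
  by rewrite Dp sa_actZ; case: n {Dp} => [|n]; rewrite ?scale0r // -p_raise.
have e : sa_act (opX R + g) (shiftp 1 (p n)) = p n.+1 + n%:R *: p n.
  rewrite p_raise -YDp -sa_actDr; congr sa_act.
  by rewrite sa_act_opD addrC subrK.
have Sp : shiftp 1 (p n) = p n + n%:R *: seq_pred p n.
  by rewrite -Dp sa_act_opD addrCA subrr addr0.
move: e; rewrite charlier_raising shiftp_comp addNr shiftp_id Sp.
rewrite scalerDr scalerA opprD => /(congr1 (fun h => h + a *: p n +
   (a * n%:R) *: seq_pred p n - (a + beta) *: p n)).
rewrite mulrDl mul_polyC scalerBl scalerDl => e'.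
by rewrite [LHS](_ : _ = 'X * p n + (a *: p n + beta *: p n) +
  (- (a *: p n) - (a * n%:R) *: seq_pred p n) + a *: p n +
  (a * n%:R) *: seq_pred p n - (a *: p n + beta *: p n)); [rewrite e'|]; ring.
Qed.

Lemma charlier_eigenbasis n : p n = charlier a n \Po y.
Proof.
rewrite -charlier_raising_iter; elim: n => [|n IHn].
  by rewrite expr0 sa_act1.
by rewrite exprS sa_actM -IHn.
Qed.

End Charlier.

End OrthogonalityMeasures.

Theorem theorem6p1 (R : realType) (g : shiftalg R) (lambda : R)
    (E H F : shiftalg R) (p : nat -> {poly R})
    (hEHF : fixed_lowering_params g lambda E H F)
    (hp : monic_eigenbasis H lambda p) :
  [/\ (exists mu : {measure set (measurableTypeR R) -> \bar R},
         orthogonality_measure p mu)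
      <->
      (exists a beta : R, 0 < a /\
         g = - sa_const a + sa_const (a + beta) * opSV R),
      (exists a beta : R, 0 < a /\
         g = - sa_const a + sa_const (a + beta) * opSV R)
      <->
      (in_L1 E H F /\
       exists cm1 c0 : R,
         g = sa_const cm1 * opSV R + sa_const c0 /\ c0 < 0)
    & forall a beta : R, 0 < a ->
      g = - sa_const a + sa_const (a + beta) * opSV R ->
      [/\ fps_egf p =1
            fps_mul (fps_exp (- a)%:P) (fps_binpow ('X + (a + beta)%:P)),
          forall n, 'X * p n =
            p n.+1 + (n%:R - beta) *: p n + (a * n%:R) *: seq_pred p n,
          forall n, p n = charlier a n \Po ('X + (a + beta)%:P),
          forall mu nu : {measure set (measurableTypeR R) -> \bar R},
            orthogonality_measure p mu -> orthogonality_measure p nu ->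
            exists c : R, 0 < c /\
              forall A, measurable A -> mu A = (c%:E * nu A)%E
        & forall mu : {measure set (measurableTypeR R) -> \bar R},
            orthogonality_measure p mu ->
            exists c : R, 0 < c /\
              mu (~` [set k%:R - a - beta | k in [set: nat]]) = 0%E /\
              forall k : nat, mu [set k%:R - a - beta] =
                (c * (expR (- a) * a ^+ k / k`!%:R))%:E]].
Proof.
have [[_ FE] g_const HE EE] := hEHF; rewrite HE in hp.
have [pm ps p0 praise plower] := monic_eigenbasisP g_const hp.
split.
- split=> [[mu orth]|[a [beta [a0 gE]]]]; first exact: orthogonality_param orth.
  exists (poisson_line a (a + beta)); rewrite gE in praise.
  exact: poisson_line_orthogonality.
- have constN (c : R) : sa_const (- c) = - sa_const c.
    by apply/eqP; rewrite -addr_eq0 /sa_const /sa_poly -sa_monoD -polyCD addNr sa_mono0.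
  split=> [[a [beta [a0 gE]]]|[_ [cm1 [c0 [gE c00]]]]].
    split; last by exists (a + beta), (- a); rewrite constN oppr_lt0 addrC.
    by rewrite EE HE FE gE -constN; exact: charlier_in_L1.
  (* Matching coefficients: [- a = c0] and [a + beta = cm1]. *)
  exists (- c0), (cm1 + c0); rewrite oppr_gt0; split=> //.
  by rewrite constN opprK [- c0 + _]addrC addrK gE addrC.
move=> a beta a0 gE; rewrite gE in praise.
have pE := charlier_eigenbasis p0 praise.
have pb (k : nat) : k%:R - a - beta = k%:R - (a + beta) :> R by rewrite opprD addrA.
(* Every orthogonality measure is its total mass times one fixed Poisson measure; uniqueness,
   support and weights are all read off from this. *)
have muP := orthogonality_measure_poisson a0 p0 pm ps praise.
split=> //.
- move=> n; rewrite -charlier_egf; congr (_ / _); exact: pE.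
- exact: charlier_recurrence.
- move=> mu nu orthmu orthnu.
  have L1 := orthogonality_mass orthmu; have L2 := orthogonality_mass orthnu.
  exists (moment_functional mu 1 / moment_functional nu 1); split.
    exact: divr_gt0.
  move=> A mA; rewrite (muP mu) // (muP nu) // muleA -EFinM divfK //.
  by rewrite gt_eqF.
- move=> mu orth; exists (moment_functional mu 1).
  split; first exact: orthogonality_mass orth.
  split=> [|k].
    rewrite (_ : [set _ | _ in _] = shifted_nat (a + beta)); last first.
      by congr image; apply/funext.
    rewrite (muP mu) ?poisson_line_shifted_natC ?mule0 //.
    by apply: measurableC; exact: measurable_shifted_nat.
  rewrite pb (muP mu) //.
  rewrite poisson_line_atom -EFinM; congr (_ * _)%:E.
  by rewrite /poisson_pmf a0 mulrC mulrA.
Qed.
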